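(* Let $\{\mathrm P_N\}$ be a sequence of priors as described in the context. Suppose that $\{\mathrm P_N\}$ has overlap rate function $r$ satisfying, for all $t\in[0,1]$, $$r(t)\ge\frac{2t}{1+t}.$$ Then $\{\mathrm P_N\}$ satisfies the all-or-nothing phenomenon with critical SNR $\lambda_N=2\log M_N$.
   Context: Gaussian additive model: for each $N$, $\mathrm P_N$ is the uniform distribution on a finite subset of the unit sphere of $\mathbb R^N$; the cardinality of this subset is $M_N$, and $M_N\to\infty$ as $N\to\infty$. For $\lambda\ge 0$ one observes $\mathbf Y=\sqrt{\lambda}\,\mathbf X+\mathbf Z$, where $\mathbf X\sim \mathrm P_N$ and $\mathbf Z\in\mathbb R^N$ has i.i.d. standard Gaussian entries and is independent of $\mathbf X$. Define $\mathrm{MMSE}_N(\lambda)=\mathbb E\|\mathbf X-\mathbb E[\mathbf X\mid\mathbf Y]\|^2$. The sequence $\{\mathrm P_N\}$ satisfies the all-or-nothing phenomenon with critical SNR $\{\lambda_N\}$ if for every fixed $\beta\ge 0$ with $\beta\neq 1$, $\lim_{N\to\infty}\mathrm{MMSE}_N(\beta\lambda_N)$ equals $1$ if $\beta<1$ and $0$ if $\beta>1$. Overlap rate function: given a non-decreasing function $r:[-1,1]\to\mathbb R_{\ge 0}$, $\{\mathrm P_N\}$ has overlap rate function $r$ if for all $t\in[-1,1]$, $$\limsup_{N\to\infty}\frac{1}{\log M_N}\log \mathrm P_N^{\otimes 2}\left[\langle\mathbf X,\mathbf X'\rangle\ge t\right]\le -r(t),$$ where $\mathbf X,\mathbf X'$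 are independent draws from $\mathrm P_N$. *)

(* Defs.v *)
From HB Require Import structures.
From mathcomp Require Import all_boot all_order all_algebra finmap.
From mathcomp Require Import all_classical all_reals all_analysis.

Set Implicit Arguments.
Unset Strict Implicit.
Unset Printing Implicit Defensive.
Import Order.TTheory GRing.Theory Num.Theory.
Import numFieldNormedType.Exports.

Local Open Scope classical_set_scope.
Local Open Scope ring_scope.

(* R^n is n.-tuple R: this is the type that the library equips with the
   product sigma-algebra (matrices carry none). *)

Section euclidean.
Context {R : realType} {n : nat}.

Definition dotp (x y : n.-tuple R) : R := \sum_(i < n) tnth x i * tnth y i.

Definition enorm (x : n.-tuple R) : R := Num.sqrt (dotp x x).

End euclidean.

Section iterated_product.
Context d (T : measurableType d) (R : realType).

Definition tcons n (p : T * n.-tuple T) : n.+1.-tuple T :=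
  [the n.+1.-tuple T of p.1 :: p.2].

Lemma measurable_tcons n : measurable_fun [set: T * n.-tuple T] (@tcons n).
Proof. exact: measurable_cons. Qed.

HB.instance Definition _ n :=
  isMeasurableFun.Build _ _ _ _ (@tcons n) (@measurable_tcons n).

(* The law of n i.i.d. draws from P; prod_probE below is its characterization
   on boxes. *)
Fixpoint prod_prob (P : probability T R) n : probability (n.-tuple T) R :=
  if n is m.+1 then distribution (P \x prod_prob P m)%E (@tcons m)
  else \d_([tuple] : 0.-tuple T).

Lemma measurable_box n (A : 'I_n -> set T) :
  (forall i, measurable (A i)) ->
  measurable [set x : n.-tuple T | forall i, A i (tnth x i)].
Proof.
move=> mA.
rewrite (_ : [set _ | _] =
    \big[setI/setT]_(i < n) ((fun x : n.-tuple T => tnth x i) @^-1` A i)).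
  apply: bigsetI_measurable => i _.
  by rewrite -[X in measurable X]setTI; exact: measurable_tnth.
apply/seteqP; split => x /=.
  by move=> Ax; rewrite -bigcap_seq => i /= _; exact: Ax.
by rewrite -bigcap_seq => Ax i; apply: (Ax i); rewrite /= mem_index_enum.
Qed.

Lemma prod_probE (P : probability T R) n (A : 'I_n -> set T) :
  (forall i, measurable (A i)) ->
  (prod_prob P n [set x | forall i, A i (tnth x i)] = \prod_(i < n) P (A i))%E.
Proof.
elim: n A => [|n IHn] A mA.
  by rewrite big_ord0 /= diracE mem_set//= => -[].
rewrite big_ord_recl -(IHn (fun i => A (lift ord0 i)) (fun=> mA _)).
have mB := measurable_box (fun i => mA (lift ord0 i)).
rewrite -(product_measure1E _ _ (mA ord0) mB) /= /distribution /pushforward.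
congr (product_measure1 _ _ _); apply/seteqP; split => -[x y] /=.
  by move=> Axy; split => [|i]; [exact: (Axy ord0)|
    have := Axy (lift ord0 i); rewrite tnthS].
by move=> [Ax Ay] i; case: (unliftP ord0 i) => [j|] ->; rewrite ?tnthS.
Qed.

End iterated_product.

Section std_gaussian.
Context (R : realType).

(* The library has normal_prob on measurableTypeR R, that is R with the same
   Borel sigma-algebra under another display; the identity transports it. *)
Definition idTR : measurableTypeR R -> R := idfun.

Lemma measurable_idTR : measurable_fun [set: measurableTypeR R] idTR.
Proof. exact: (@measurable_id _ _ setT). Qed.

HB.instance Definition _ :=
  isMeasurableFun.Build _ _ _ _ idTR measurable_idTR.

Definition std_normal : probability R R := distribution (normal_prob 0 1) idTR.

Definition std_gaussian (n : nat) : probability (n.-tuple R) R :=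
  prod_prob std_normal n.

End std_gaussian.

(* Counting measure on S, normalized to total mass 1. For S empty, where no
   uniform distribution exists, mnormalize returns the given Dirac mass. *)
Definition uniform_prior (R : realType) (n : nat) (S : {fset n.-tuple R}) :
    probability (n.-tuple R) R :=
  let x0 : n.-tuple R := [tuple 0 | i < n] in
  mnormalize (msum (fun k => \d_(nth x0 (enum_fset S) k)) #|` S|) \d_x0.

Lemma uniform_priorE (R : realType) (n : nat) (S : {fset n.-tuple R})
    (A : set (n.-tuple R)) : S != fset0 ->
  uniform_prior S A =
    ((count (fun x => x \in A) (enum_fset S))%:R / #|` S|%:R)%:E.
Proof.
move=> S0; set x0 : n.-tuple R := [tuple 0 | i < n].
have E (B : set (n.-tuple R)) :
    msum (fun k => \d_(nth x0 (enum_fset S) k)) #|` S| B =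
    ((count (fun x => x \in B) (enum_fset S))%:R : R)%:E.
  rewrite /msum -sum1_count natr_sum -sumEFin/=.
  rewrite [RHS](big_nth x0) big_mkord [RHS]big_mkcond/=; apply: eq_bigr => i _.
  by rewrite diracE; case: (_ \in _).
have T : count (fun x => x \in [set: n.-tuple R]) (enum_fset S) = #|` S|.
  by rewrite (@eq_count _ _ predT) ?count_predT// => x; rewrite /= in_setT.
rewrite /uniform_prior /= /mnormalize /= -/x0 !E T.
rewrite ifF; first by rewrite E EFinM.
by rewrite orbF eqe pnatr_eq0 cardfs_eq0 (negbTE S0).
Qed.

Section conditional_expectation.
Context d (T : measurableType d) (R : realType) (P : probability T R).

Definition is_cond_exp (G : set (set T)) (X W : T -> R) : Prop :=
  [/\ P.-integrable setT (EFin \o W),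
      forall B, measurable B -> G (W @^-1` B) &
      forall A, G A ->
        (\int[P]_(w in A) (W w)%:E = \int[P]_(w in A) (X w)%:E)%E].

(* sigma(Y) *)
Definition sigma_of d' (T' : measurableType d') (Y : T -> T') : set (set T) :=
  preimage_set_system setT Y measurable.

(* A version of E[X | Y]; versions agree P-almost surely. The default 0 is
   used only if there is no version, e.g. when X is not integrable. *)
Definition cond_exp d' (T' : measurableType d') (X : T -> R) (Y : T -> T') :
    T -> R :=
  xget (fun=> 0) (is_cond_exp (sigma_of Y) X).

End conditional_expectation.

Section gaussian_additive_model.
Context {R : realType} {n : nat}.
Variables (mu : probability (n.-tuple R) R) (lambda : R).

(* The sample space is R^n * R^n with joint law mu \x N(0, I_n): under it
   the coordinates X = fst and Z = snd are independent with X ~ mu and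
   Z ~ N(0, I_n). *)
Definition model_law : probability (n.-tuple R * n.-tuple R)%type R :=
  (mu \x std_gaussian R n)%E.

Definition observation (w : n.-tuple R * n.-tuple R) : n.-tuple R :=
  [tuple Num.sqrt lambda * tnth w.1 i + tnth w.2 i | i < n].

Definition posterior_mean (w : n.-tuple R * n.-tuple R) : n.-tuple R :=
  [tuple cond_exp model_law (fun v => tnth v.1 i) observation w | i < n].

Definition mmse : \bar R :=
  ('E_model_law[fun w =>
     (enorm [tuple tnth w.1 i - tnth (posterior_mean w) i | i < n] ^+ 2)%R])%E.

End gaussian_additive_model.

Section sequences_of_priors.
Context {R : realType}.
Variable mu : forall N : nat, probability (N.-tuple R) R.

Definition all_or_nothing (lambda : nat -> R) : Prop :=
  forall beta : R, 0 <= beta -> beta != 1 ->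
    mmse (mu N) (beta * lambda N) @[N --> \oo] -->
      (if beta < 1 then 1%E else 0%E).

(* lne is the extended logarithm, with lne 0 = -oo. *)
Definition overlap_rate_function (M : nat -> nat) (r : R -> R) : Prop :=
  [/\ {in `[-1, 1] &, {homo r : s t / s <= t}},
      {in `[-1, 1], forall t, 0 <= r t} &
      {in `[-1, 1], forall t,
        (limn_esup (fun N => (ln (M N)%:R)^-1%:E *
           lne ((mu N \x mu N) [set p | (t <= dotp p.1 p.2)%R]))
         <= (- r t)%:E)%E}].

End sequences_of_priors.

(* Main.v *)
Require Import Defs.
From HB Require Import structures.
From mathcomp Require Import all_boot all_order all_algebra finmap.
From mathcomp Require Import all_classical all_reals all_analysis.
From mathcomp Require Import measurable_realfun ring lra.

Set Implicit Arguments.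
Unset Strict Implicit.
Unset Printing Implicit Defensive.
Import Order.TTheory GRing.Theory Num.Theory.
Import numFieldNormedType.Exports.

Local Open Scope classical_set_scope.
Local Open Scope ring_scope.

(** Write M for the number of points of the support, L = ln M and
lam = 2 beta L. Points of the support have norm 1, so the posterior weight of
x given y is proportional to e^(sqrt lam <x, y>), and the MMSE is the mean
square distance from the signal to the barycenter of these weights. Hence the
MMSE tends to 0 if the posterior mass of the points x with <x0, x> < 1 - eps
vanishes on average, x0 being the signal (mmse_le); and it tends to 1 if the
posterior mass of the points with <x0, x> >= eps vanishes (mmse_ge), the MMSE
being at most 1 anyway (mmse_le1).

Both masses are controlled by a union bound with first moments only. Let
y = sqrt lam x0 + z and t = <x0, x>. Except with small probability, <x0, z> is
negligible with respect to sqrt L, so that the only relevant fluctuation of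
<x, z> is that of its part orthogonal to x0, which has variance 1 - t ^ 2.
 - If beta > 1 (average_mass_le_ratio), the posterior weight of x is at most 1
   and at most its ratio to the weight of x0, hence at most the ratio to any
   power theta in [0, 1]. For t >= 0 the best power is theta = 1 / (1 + t), and
   a weight is then of order M ^ (- beta (1 - t) / (1 + t)) on average.
 - If beta < 1 (average_mass_le_threshold), the weight of x is compared with
   the normalizing sum instead. The normalizing sum is at least M ^ (1 - k)
   with high probability, because by a change of measure its inverse has mean
   1 / M. The same power theta gives weights of order
   M ^ ((beta t - 1 + k) / (1 + t)).
On average M ^ (1 - r t) points have overlap about t with the signal, and
1 - r t <= (1 - t) / (1 + t). Adding up the exponents, the points of overlap t
contribute M ^ ((1 - beta) (1 - t) / (1 + t)) in the first case and
M ^ ((k - (1 - beta) t) / (1 + t)) in the second one. These exponents are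
negative on the relevant range of t, and a finite grid of values of t makes
the union bound uniform (pair_sum_vanish).

The posterior enters through the shift formula for the Gaussian measure
(std_gaussian_shift). It gives at once the Bayes formula (posterior_tower), from
which the barycenter is a version of the conditional expectation, and the
exponential moments used in the union bound. *)

(** * Shifts of the Gaussian law *)

Section normal.
Context {R : realType}.
Local Notation mu := (@lebesgue_measure R).

Lemma lebesgue_measure_shift (a : R) (A : set R) : measurable A ->
  pushforward mu (fun x : measurableTypeR R => x + a : measurableTypeR R) A
  = mu A.
Proof.
move=> mA.
have ms : measurable_fun [set: measurableTypeR R]
    (fun x : measurableTypeR R => x + a : measurableTypeR R).
  exact: measurable_funD.
pose m_ := isMeasurableFun.Build _ _ _ _ _ ms.
pose phi : {mfun _ >-> _} :=
  HB.pack (fun x : measurableTypeR R => x + a : measurableTypeR R) m_.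
apply/esym.
apply: (@lebesgue_measure_unique _ (pushforward mu phi)) => //= _ [[u v]] _ <-.
rewrite /pushforward.
have -> : phi @^-1` `]u, v] = `]u - a, v - a]%classic.
  by apply/seteqP; split => x /=; rewrite !in_itv/= lerBrDr ltrBlDr.
rewrite !lebesgue_measure_itv/= !lte_fin ltrD2r.
by case: ifP => // _; congr (_%:E); ring.
Qed.

(** Almost everywhere, the density is the Radon-Nikodym derivative, for which the
change of variables is available. *)
Lemma ge0_integral_normal_prob (f : measurableTypeR R -> \bar R) :
  measurable_fun setT f -> (forall x, (0 <= f x)%E) ->
  (\int[normal_prob 0 1]_x f x = \int[mu]_x (f x * (normal_pdf 0 1 x)%:E))%E.
Proof.
move=> mf f0.
have dom := normal_prob_dominates (0 : R) 1.
rewrite -(Radon_Nikodym_SigmaFinite.change_of_variables dom)//.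
apply: ae_eq_integral => //.
- apply: emeasurable_funM => //.
  exact: measurable_int (Radon_Nikodym_SigmaFinite.f_integrable dom).
- by apply: emeasurable_funM => //; apply/measurable_EFinP; exact: measurable_normal_pdf.
- apply: ae_eqe_mul2l; apply: integral_ae_eq => //.
  + exact: Radon_Nikodym_SigmaFinite.f_integrable.
  + by apply/measurable_EFinP; exact: measurable_normal_pdf.
  + by move=> E _ mE; rewrite -Radon_Nikodym_SigmaFinite.f_integral.
Qed.

Lemma ge0_integral_std_normal (f : R -> \bar R) :
  measurable_fun setT f -> (forall x, (0 <= f x)%E) ->
  (\int[std_normal R]_x f x = \int[mu]_x (f x * (normal_pdf 0 1 x)%:E))%E.
Proof.
move=> mf f0; rewrite /std_normal ge0_integral_distribution//.
exact: ge0_integral_normal_prob.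
Qed.

(** Translate the Lebesgue measure, then complete the square in the density. *)
Lemma std_normal_shift (a : R) (f : R -> \bar R) :
  measurable_fun setT f -> (forall x, (0 <= f x)%E) ->
  (\int[std_normal R]_x f (x + a)%R =
   \int[std_normal R]_x ((expR (a * x - a ^+ 2 / 2))%:E * f x))%E.
Proof.
move=> mf f0.
have mexp : measurable_fun [set: R] (fun x : R => expR (a * x - a ^+ 2 / 2)).
  by apply: measurableT_comp => //; apply: measurable_funB.
rewrite !ge0_integral_std_normal//; last 3 first.
- by apply: emeasurable_funM => //; apply/measurable_EFinP.
- by move=> x; rewrite mule_ge0// lee_fin expR_ge0.
- by apply: (measurableT_comp mf); exact: measurable_funD.
pose g (x : R) := (f x * (normal_pdf 0 1 (x - a)%R)%:E)%E.
have mg : measurable_fun [set: R] g.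
  apply: emeasurable_funM => //; apply/measurable_EFinP.
  apply: measurableT_comp; first exact: measurable_normal_pdf.
  exact: measurable_funB.
have g0 x : (0 <= g x)%E by rewrite mule_ge0// lee_fin normal_pdf_ge0.
transitivity (\int[mu]_x g (x + a)%R)%E.
  by apply: eq_integral => x _; rewrite /g addrK.
transitivity (\int[mu]_x g x)%E.
  pose sh (x : measurableTypeR R) : measurableTypeR R := x + a.
  have ms : measurable_fun setT sh by exact: measurable_funD.
  transitivity (\int[mu]_(x in sh @^-1` setT) (g \o sh) x)%E; first by [].
  rewrite -(ge0_integral_pushforward ms)//.
  by apply: eq_measure_integral => A mA _; exact: lebesgue_measure_shift.
apply: eq_integral => x _; rewrite /g muleAC muleC; congr (_ * _)%E.
rewrite -EFinM; congr (_%:E).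
rewrite !normal_pdfE ?oner_neq0// /normal_fun mulrCA; congr (_ * _).
rewrite -expRD; by congr expR; field.
Qed.

End normal.

Section tuples.
Context {R : realType} {n : nat}.
Implicit Types x y z : n.-tuple R.

Definition addt x y : n.-tuple R := [tuple tnth x i + tnth y i | i < n].

Definition scalet (a : R) x : n.-tuple R := [tuple a * tnth x i | i < n].

Lemma dotpC x y : dotp x y = dotp y x.
Proof. by apply: eq_bigr => i _; rewrite mulrC. Qed.

Lemma dotpDl x y z : dotp (addt x y) z = dotp x z + dotp y z.
Proof.
rewrite /dotp -big_split/=; apply: eq_bigr => i _.
by rewrite tnth_mktuple mulrDl.
Qed.

Lemma dotpDr x y z : dotp z (addt x y) = dotp z x + dotp z y.
Proof. by rewrite dotpC dotpDl !(dotpC z). Qed.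

Lemma dotpZl a x y : dotp (scalet a x) y = a * dotp x y.
Proof.
rewrite /dotp big_distrr; apply: eq_bigr => i _.
by rewrite tnth_mktuple/= mulrA.
Qed.

Lemma dotpZr a x y : dotp x (scalet a y) = a * dotp x y.
Proof. by rewrite dotpC dotpZl dotpC. Qed.

Lemma dotp_ge0 x : 0 <= dotp x x.
Proof. by apply: sumr_ge0 => i _; rewrite -expr2 sqr_ge0. Qed.

Lemma measurable_dotp x : measurable_fun setT (dotp x).
Proof.
apply: measurable_sum => i; apply: measurable_funM => //.
exact: measurable_tnth.
Qed.

Lemma measurable_addt x : measurable_fun setT (addt x).
Proof.
apply/measurable_fun_tnthP => i.
rewrite (_ : _ \o _ = fun z => tnth x i + tnth z i); last first.
  by apply/funext => z /=; rewrite tnth_mktuple.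
by apply: measurable_funD => //; exact: measurable_tnth.
Qed.

Lemma dotp_enorm1 x : enorm x = 1 -> dotp x x = 1.
Proof.
by move=> h; rewrite -[RHS](expr1n _ 2) -h /enorm sqr_sqrtr// dotp_ge0.
Qed.

End tuples.

Section iterated_integral.
Context d (T : measurableType d) (R : realType) (P : probability T R).
Local Open Scope ereal_scope.

Lemma ge0_integral_prod_prob n (f : n.+1.-tuple T -> \bar R) :
  measurable_fun setT f -> (forall x, 0 <= f x) ->
  \int[prod_prob P n.+1]_z f z =
  \int[P]_x \int[prod_prob P n]_y f (tcons (x, y)).
Proof.
move=> mf f0; rewrite /= ge0_integral_distribution//.
rewrite fubini_tonelli1//; last by move=> x; exact: f0.
apply: (measurableT_comp mf); exact: measurable_tcons.
Qed.

End iterated_integral.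

Lemma addt_tcons (R : realType) n (v : n.+1.-tuple R) x (y : n.-tuple R) :
  addt v (tcons (x, y)) = tcons (x + thead v, addt (behead_tuple v) y).
Proof.
apply: eq_from_tnth => i; rewrite tnth_mktuple.
case: (unliftP ord0 i) => [j|] ->; rewrite ?tnthS ?tnth0 /=.
  rewrite tnth_mktuple tnth_behead; congr (tnth v _ + _).
  by apply/val_inj; rewrite /= inordK// ltnS.
by rewrite addrC.
Qed.

Lemma dotp_tcons (R : realType) n (v : n.+1.-tuple R) x (y : n.-tuple R) :
  dotp v (tcons (x, y)) = thead v * x + dotp (behead_tuple v) y.
Proof.
rewrite /dotp big_ord_recl; congr (_ + _).
apply: eq_bigr => i _; rewrite tnthS tnth_behead; congr (tnth v _ * _).
by apply/val_inj; rewrite /= inordK// ltnS.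
Qed.

Lemma dotp_thead (R : realType) n (v w : n.+1.-tuple R) :
  dotp v w = thead v * thead w + dotp (behead_tuple v) (behead_tuple w).
Proof.
have -> : w = tcons (thead w, behead_tuple w) by rewrite [LHS]tuple_eta; apply/val_inj.
rewrite dotp_tcons theadE; congr (_ + dotp _ _); exact/val_inj.
Qed.

(** The Cameron-Martin formula for the standard Gaussian law of R^n: the
coordinates are shifted one after the other, by Tonelli. *)
Lemma std_gaussian_shift (R : realType) n (v : n.-tuple R)
    (f : n.-tuple R -> \bar R) :
  measurable_fun setT f -> (forall x, (0 <= f x)%E) ->
  (\int[std_gaussian R n]_z f (addt v z) =
   \int[std_gaussian R n]_z ((expR (dotp v z - dotp v v / 2))%:E * f z))%E.
Proof.
elim: n v f => [|n IHn] v f mf f0.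
  apply: eq_integral => z _; rewrite /dotp !big_ord0 mul0r subr0 expR0 mul1e.
  by congr f; rewrite (tuple0 z) tuple0.
have mexp k (w : k.-tuple R) : measurable_fun setT
    (fun z => (expR (dotp w z - dotp w w / 2))%:E).
  apply/measurable_EFinP; apply: measurableT_comp => //.
  by apply: measurable_funB => //; exact: measurable_dotp.
rewrite /std_gaussian ge0_integral_prod_prob//; last first.
  by apply: (measurableT_comp mf); exact: measurable_addt.
rewrite [RHS]ge0_integral_prod_prob; last 2 first.
- exact: (emeasurable_funM (mexp _ v) mf).
- by move=> x; rewrite mule_ge0// lee_fin expR_ge0.
have mft : measurable_fun setT (fun p : R * n.-tuple R => f (tcons p)).
  by apply: (measurableT_comp mf); exact: measurable_tcons.
pose w := behead_tuple v.
pose h (p : R * n.-tuple R) :=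
  ((expR (dotp w p.2 - dotp w w / 2))%:E * f (tcons p))%E.
have mh : measurable_fun setT h.
  apply: emeasurable_funM => //.
  exact: (measurableT_comp (mexp n w)).
have h0 p : (0 <= h p)%E by rewrite mule_ge0// lee_fin expR_ge0.
pose G x := (\int[std_gaussian R n]_y h (x, y))%E.
transitivity (\int[std_normal R]_x G (x + thead v)%R)%E.
  apply: eq_integral => x _; rewrite /G -IHn//.
    by apply: eq_integral => y _; rewrite addt_tcons.
  by apply: (measurableT_comp mft); exact: measurable_pair1.
rewrite std_normal_shift; last 2 first.
- exact: (measurable_fun_fubini_tonelli_F h).
- by move=> x; apply: integral_ge0 => y _; exact: h0.
apply: eq_integral => x _; rewrite -ge0_integralZl//; last first.
  by apply: (measurableT_comp mh); exact: measurable_pair1.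
apply: eq_integral => y _; rewrite /h /= muleA -EFinM -expRD.
congr ((expR _)%:E * _)%E; rewrite dotp_tcons (dotp_thead v v) -/w.
by field.
Qed.

Lemma integral_std_gaussian_cst (R : realType) n (r : R) :
  (\int[std_gaussian R n]_z r%:E = r%:E)%E.
Proof.
rewrite integral_cst// -[RHS]mule1; congr (_ * _)%E; exact: probability_setT.
Qed.

(** * Uniform priors and uniqueness of the conditional expectation *)

Section uniform_integral.
Context {R : realType} {n : nat}.
Variable S : {fset n.-tuple R}.
Hypothesis S0 : S != fset0.
Local Open Scope ereal_scope.

Lemma cardfs_natr_gt0 : (0 < #|` S|%:R :> R)%R.
Proof. by rewrite ltr0n cardfs_gt0. Qed.

Lemma ge0_integral_uniform_prior (f : n.-tuple R -> \bar R) :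
  measurable_fun setT f -> (forall x, 0 <= f x) ->
  \int[uniform_prior S]_x f x = (#|` S|%:R^-1)%:E * \sum_(x <- S) f x.
Proof.
move=> mf f0; set x0 : n.-tuple R := [tuple 0%R | i < n].
pose m k : {measure set (n.-tuple R) -> \bar R} := \d_(nth x0 (enum_fset S) k).
have k0 : (0 <= #|` S|%:R^-1 :> R)%R by rewrite invr_ge0.
transitivity (\int[mscale (NngNum k0) (msum m #|` S|)]_x f x).
  apply: eq_measure_integral => A mA _.
  rewrite [LHS]uniform_priorE// /mscale/= /msum EFinM muleC; congr (_ * _).
  rewrite -sum1_count natr_sum -sumEFin/= (big_nth x0) big_mkord big_mkcond/=.
  by apply: eq_bigr => i _; rewrite /m /= diracE; case: (_ \in _).
rewrite ge0_integral_mscale//; congr (_ * _).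
rewrite ge0_integral_measure_sum// [RHS](big_nth x0) big_mkord.
by apply: eq_bigr => i _; rewrite /m integral_dirac// diracT mul1e.
Qed.

Lemma ge0_integral_model_law (f : n.-tuple R * n.-tuple R -> \bar R) :
  measurable_fun setT f -> (forall x, 0 <= f x) ->
  \int[model_law (uniform_prior S)]_w f w =
  (#|` S|%:R^-1)%:E * \sum_(x <- S) \int[std_gaussian R n]_z f (x, z).
Proof.
move=> mf f0; rewrite /model_law fubini_tonelli1//.
rewrite ge0_integral_uniform_prior//.
  exact: measurable_fun_fubini_tonelli_F.
by move=> x; apply: integral_ge0.
Qed.

Lemma uniform_prior_prod (A : set (n.-tuple R * n.-tuple R)) : measurable A ->
  (uniform_prior S \x uniform_prior S) A =
  ((\sum_(x <- S) \sum_(y <- S) ((x, y) \in A)%:R) / #|` S|%:R ^+ 2)%:E.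
Proof.
move=> mA.
have mi : measurable_fun setT (fun w => (\1_A w : R)%:E).
  by apply/measurable_EFinP; exact: measurable_indic.
transitivity (\int[uniform_prior S \x uniform_prior S]_w (\1_A w : R)%:E).
  by rewrite integral_indic// setIT.
rewrite fubini_tonelli1//.
rewrite ge0_integral_uniform_prior//; last 2 first.
- exact: (measurable_fun_fubini_tonelli_F _ mi).
- by move=> x; apply: integral_ge0.
under eq_bigr => x _.
  rewrite /fubini_F ge0_integral_uniform_prior//; last first.
    by apply: (measurableT_comp mi); exact: measurable_pair1.
  under eq_bigr do rewrite indicE.
  rewrite sumEFin -EFinM.
  over.
rewrite sumEFin -EFinM; congr (_%:E).
rewrite -big_distrr/= mulrA mulrC; congr (_ * _)%R.
by field; rewrite gt_eqF// cardfs_natr_gt0.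
Qed.

End uniform_integral.

Section conditional_expectation_uniqueness.
Context d (T : measurableType d) (R : realType) (P : probability T R).
Variable G : set (set T).
Hypotheses (G_sigma : sigma_algebra setT G) (G_meas : G `<=` measurable).
Local Open Scope ereal_scope.

Let G_lt (X W : T -> R) : (forall B, measurable B -> G (X @^-1` B)) ->
  (forall B, measurable B -> G (W @^-1` B)) -> G [set w | (X w < W w)%R].
Proof.
move=> GX GW; rewrite -(sigma_algebra_id G_sigma).
(* A function with preimages in G is measurable for the sigma-algebra generated
   by G, which is G itself. *)
have mG (V : T -> R) : (forall B, measurable B -> G (V @^-1` B)) ->
    measurable_fun (setT : set (g_sigma_algebraType G)) V.
  by move=> GV _ B mB; rewrite setTI; apply: sub_sigma_algebra; exact: GV.
have /(_ measurableT [set true]) := measurable_fun_ltr (mG _ GX) (mG _ GW).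
by rewrite setTI; apply.
Qed.

Let cond_exp_le (X W1 W2 : T -> R) :
  is_cond_exp P G X W1 -> is_cond_exp P G X W2 ->
  \forall w \ae P, (W1 w <= W2 w)%R.
Proof.
move=> [i1 G1 e1] [i2 G2 e2].
pose A := [set w | (W2 w < W1 w)%R].
have GA : G A by exact: G_lt.
have mA := G_meas GA.
have iA (W : T -> R) : P.-integrable setT (EFin \o W) -> P.-integrable A (EFin \o W).
  exact: integrableS.
have mB : measurable_fun A (fun w => (W1 w - W2 w)%:E).
  apply: (measurable_int P); under eq_fun do rewrite EFinB.
  exact: integrableB (iA _ i1) (iA _ i2).
have : \int[P]_(w in A) `|(W1 w - W2 w)%:E| = 0.
  rewrite (eq_integral (fun w => (W1 w)%:E - (W2 w)%:E)); last first.
    move=> w /set_mem/= wA; rewrite -EFinB.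
    by rewrite /= ger0_norm// subr_ge0 ltW.
  rewrite integralB//; [|exact: iA|exact: iA].
  rewrite e1// e2// subee//.
  by rewrite -e2//; apply: integrable_fin_num => //; exact: iA.
move/(ae_eq_integral_abs P mA mB) => /=; apply: filterS => w h.
rewrite leNgt; apply/negP => Aw; have [] := h Aw.
by move/eqP; rewrite subr_eq0 gt_eqF.
Qed.

(** The set where one version exceeds the other belongs to G, so both versions have
the same integral on it: it is negligible. *)
Lemma cond_exp_unique (X W1 W2 : T -> R) :
  is_cond_exp P G X W1 -> is_cond_exp P G X W2 ->
  \forall w \ae P, W1 w = W2 w.
Proof.
move=> c1 c2; have := cond_exp_le c2 c1; have := cond_exp_le c1 c2.
by apply: filterS2 => w h1 h2; apply/eqP; rewrite eq_le h1 h2.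
Qed.

End conditional_expectation_uniqueness.

(** * The posterior and the Bayes formula *)

Section posterior.
Context {R : realType} {n : nat}.
Variables (S : {fset n.-tuple R}) (lam : R).
Hypothesis S0 : S != fset0.
Hypothesis S_sphere : forall x, x \in S -> dotp x x = 1.
Hypothesis lam0 : 0 <= lam.
Implicit Types x y z : n.-tuple R.

(** The density at y of the law of sqrt lam x + Z with respect to the law of Z, for
x of norm 1. *)
Definition likelihood x y : R := expR (Num.sqrt lam * dotp x y - lam / 2).

(** M times the density of the law of the observation with respect to the law of
the noise. *)
Definition partition_fun y : R := \sum_(x <- S) likelihood x y.

Definition posterior x y : R := likelihood x y / partition_fun y.

Definition posterior_barycenter y : n.-tuple R :=
  [tuple \sum_(x <- S) posterior x y * tnth x i | i < n].

Definition obs x z : n.-tuple R := addt (scalet (Num.sqrt lam) x) z.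

Lemma likelihood_gt0 x y : 0 < likelihood x y.
Proof. exact: expR_gt0. Qed.

Lemma partition_fun_gt0 y : 0 < partition_fun y.
Proof.
have /fset0Pn[x0 x0S] := S0.
rewrite /partition_fun (big_fsetD1 x0)//= ltr_pwDl ?likelihood_gt0//.
by apply: sumr_ge0 => x _; exact/ltW/likelihood_gt0.
Qed.

Lemma posterior_ge0 x y : 0 <= posterior x y.
Proof. by rewrite divr_ge0// ltW// ?likelihood_gt0// partition_fun_gt0. Qed.

Lemma sum_posterior y : \sum_(x <- S) posterior x y = 1.
Proof. by rewrite -big_distrl/= divff// gt_eqF// partition_fun_gt0. Qed.

Lemma posterior_le1 x y : x \in S -> posterior x y <= 1.
Proof.
move=> xS; rewrite -(sum_posterior y) (big_fsetD1 x)//= lerDl.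
by apply: sumr_ge0 => x' _; exact: posterior_ge0.
Qed.

Lemma measurable_likelihood x : measurable_fun setT (likelihood x).
Proof.
apply: measurableT_comp => //; apply: measurable_funB => //.
by apply: measurable_funM => //; exact: measurable_dotp.
Qed.

Lemma measurable_partition_fun : measurable_fun setT partition_fun.
Proof. by apply: measurable_sum => x; exact: measurable_likelihood. Qed.

Lemma measurable_inv_partition_fun :
  measurable_fun setT (fun y => (partition_fun y)^-1).
Proof.
rewrite (_ : (fun y => _) = (fun y => partition_fun y `^ (-1))); last first.
  by apply/funext => y; rewrite powR_inv1// ltW// partition_fun_gt0.
apply: (measurableT_comp (measurable_powR (-1))).
exact: measurable_partition_fun.
Qed.

Lemma measurable_posterior x : measurable_fun setT (posterior x).
Proof.
apply: measurable_funM; first exact: measurable_likelihood.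
exact: measurable_inv_partition_fun.
Qed.

Lemma measurable_barycenter : measurable_fun setT posterior_barycenter.
Proof.
apply/measurable_fun_tnthP => i.
rewrite (_ : _ \o _ = fun y => \sum_(x <- S) posterior x y * tnth x i); last first.
  by apply/funext => y /=; rewrite tnth_mktuple.
by apply: measurable_sum => x; apply: measurable_funM => //; exact: measurable_posterior.
Qed.

Lemma measurable_obs x : measurable_fun setT (obs x).
Proof. exact: measurable_addt. Qed.

Lemma dotp_barycenter x y :
  dotp x (posterior_barycenter y) = \sum_(x' <- S) posterior x' y * dotp x x'.
Proof.
rewrite /dotp; under eq_bigr do rewrite tnth_mktuple big_distrr/=.
rewrite exchange_big/=; apply: eq_bigr => x' _.
by rewrite big_distrr/=; apply: eq_bigr => i _; rewrite mulrCA.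
Qed.

Lemma dotp_le1 x x' : x \in S -> x' \in S -> dotp x x' <= 1.
Proof.
move=> /S_sphere xx /S_sphere xx'.
have := dotp_ge0 (addt x (scalet (-1) x')).
rewrite dotpDl !dotpDr !dotpZl !dotpZr xx xx' (dotpC x' x); lra.
Qed.

Lemma dotp_geN1 x x' : x \in S -> x' \in S -> -1 <= dotp x x'.
Proof.
move=> /S_sphere xx /S_sphere xx'.
have := dotp_ge0 (addt x x').
rewrite dotpDl !dotpDr xx xx' (dotpC x' x); lra.
Qed.

Lemma dotp_barycenter_le1 x y : x \in S -> dotp x (posterior_barycenter y) <= 1.
Proof.
move=> xS; rewrite dotp_barycenter -(sum_posterior y) !big_seq.
apply: ler_sum => x' x'S; rewrite ler_piMr ?posterior_ge0//.
exact: dotp_le1.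
Qed.

Lemma dotp_barycenter_geN1 x y : x \in S -> -1 <= dotp x (posterior_barycenter y).
Proof.
move=> xS; rewrite dotp_barycenter -(sum_posterior y) -sumrN !big_seq.
apply: ler_sum => x' x'S; rewrite -mulrN1 ler_wpM2l ?posterior_ge0//.
exact: dotp_geN1.
Qed.

Lemma sqnorm_barycenterE y :
  dotp (posterior_barycenter y) (posterior_barycenter y) =
  \sum_(x <- S) posterior x y * dotp x (posterior_barycenter y).
Proof. by rewrite dotp_barycenter; apply: eq_bigr => x _; rewrite dotpC. Qed.

Lemma sqnorm_barycenter_le1 y :
  dotp (posterior_barycenter y) (posterior_barycenter y) <= 1.
Proof.
rewrite sqnorm_barycenterE -(sum_posterior y) !big_seq.
apply: ler_sum => x' x'S; rewrite ler_piMr ?posterior_ge0//.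
exact: dotp_barycenter_le1.
Qed.

Lemma ge0_integral_obs x (f : n.-tuple R -> \bar R) : x \in S ->
  measurable_fun setT f -> (forall y, (0 <= f y)%E) ->
  (\int[std_gaussian R n]_z f (obs x z) =
   \int[std_gaussian R n]_z ((likelihood x z)%:E * f z))%E.
Proof.
move=> xS mf f0; rewrite (std_gaussian_shift _ mf f0).
apply: eq_integral => z _; congr ((expR _)%:E * _)%E.
rewrite !dotpZl dotpZr S_sphere// mulr1; congr (_ - _ / _).
by rewrite -expr2 sqr_sqrtr.
Qed.

(** Summing over the signal turns the law of the observation into the law of the
noise with density partition_fun; every exact computation below rests on this
change of measure. *)
Lemma ge0_integral_mixture (g : n.-tuple R -> R) :
  measurable_fun setT g -> (forall y, 0 <= g y) ->
  (\sum_(x <- S) \int[std_gaussian R n]_z (g (obs x z))%:E =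
   \int[std_gaussian R n]_z (partition_fun z * g z)%:E)%E.
Proof.
move=> mg g0; rewrite big_seq.
under eq_bigr => x xS.
  rewrite (@ge0_integral_obs x (fun y => (g y)%:E) xS); [|exact/measurable_EFinP|by []].
  over.
rewrite -big_seq -ge0_integral_sum//; last 2 first.
- move=> x; apply: emeasurable_funM; apply/measurable_EFinP => //.
  exact: measurable_likelihood.
- by move=> x z _; rewrite mule_ge0// lee_fin// ltW// likelihood_gt0.
apply: eq_integral => z _.
by under eq_bigr do rewrite -EFinM; rewrite sumEFin big_distrl.
Qed.

(** Under the law with a given density, the inverse of the density has mean 1. This
is what makes partition_fun rarely small under the law of the observation, without
any second moment. *)
Lemma integral_inv_partition_fun :
  (\sum_(x <- S) \int[std_gaussian R n]_z ((partition_fun (obs x z))^-1)%:E = 1)%E.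
Proof.
rewrite (ge0_integral_mixture measurable_inv_partition_fun); last first.
  by move=> y; rewrite invr_ge0 ltW// partition_fun_gt0.
under eq_integral do rewrite divff ?gt_eqF ?partition_fun_gt0//.
exact: integral_std_gaussian_cst.
Qed.

(** The Bayes formula: a signal may be replaced by an independent draw from the
posterior. Both sides are the integral against the noise of the sum over x of
likelihood x z * phi x z. *)
Lemma posterior_tower (phi : n.-tuple R -> n.-tuple R -> R) :
  (forall x, measurable_fun setT (phi x)) -> (forall x y, 0 <= phi x y) ->
  (\sum_(x0 <- S) \int[std_gaussian R n]_z
     (\sum_(x <- S) posterior x (obs x0 z) * phi x (obs x0 z))%:E =
   \sum_(x <- S) \int[std_gaussian R n]_z (phi x (obs x z))%:E)%E.
Proof.
move=> mphi phi0.
pose g y := \sum_(x <- S) posterior x y * phi x y.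
rewrite (@ge0_integral_mixture g); last 2 first.
- apply: measurable_sum => x; apply: measurable_funM => //.
  exact: measurable_posterior.
- by move=> y; apply: sumr_ge0 => x _; rewrite mulr_ge0 ?posterior_ge0.
transitivity (\sum_(x <- S) \int[std_gaussian R n]_z
    ((likelihood x z)%:E * (phi x z)%:E))%E; last first.
  apply: eq_big_seq => x xS; symmetry.
  apply: (@ge0_integral_obs x (fun y => (phi x y)%:E)) => //.
    by apply/measurable_EFinP; exact: mphi.
  by move=> y; rewrite lee_fin.
rewrite -ge0_integral_sum//; last 2 first.
- move=> x; apply: emeasurable_funM; apply/measurable_EFinP => //.
  exact: measurable_likelihood.
- by move=> x z _; rewrite mule_ge0// lee_fin// ltW// likelihood_gt0.
apply: eq_integral => z _.
under [RHS]eq_bigr do rewrite -EFinM; rewrite sumEFin /g big_distrr/=.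
congr (_%:E); apply: eq_bigr => x _.
by rewrite /posterior mulrA mulrCA divff ?mulr1// gt_eqF// partition_fun_gt0.
Qed.

End posterior.

(** * The MMSE as the error of the posterior barycenter *)

Section mmse_formula.
Context {R : realType} {n : nat}.
Variables (S : {fset n.-tuple R}) (lam : R).
Hypothesis S0 : S != fset0.
Hypothesis S_sphere : forall x, x \in S -> dotp x x = 1.
Hypothesis lam0 : 0 <= lam.
Implicit Types x y z : n.-tuple R.

Local Notation mu := (uniform_prior S).
Local Notation gamma := (std_gaussian R n).
Local Notation posterior := (posterior S lam).
Local Notation barycenter := (posterior_barycenter S lam).
Local Notation obs := (obs lam).
Local Notation M := (#|` S|%:R : R).

Lemma observationE (w : n.-tuple R * n.-tuple R) :
  observation lam w = obs w.1 w.2.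
Proof. by apply: eq_from_tnth => i; rewrite !tnth_mktuple. Qed.

Lemma measurable_observation : measurable_fun setT (@observation R n lam).
Proof.
apply/measurable_fun_tnthP => i.
rewrite (_ : _ \o _ = fun w : n.-tuple R * n.-tuple R =>
    Num.sqrt lam * tnth w.1 i + tnth w.2 i); last first.
  by apply/funext => w /=; rewrite tnth_mktuple.
have mt := @measurable_tnth _ R n i.
apply: measurable_funD; first apply: measurable_funM => //.
- exact: (measurableT_comp mt measurable_fst).
- exact: (measurableT_comp mt measurable_snd).
Qed.

Lemma tnth_sphere x i : x \in S -> -1 <= tnth x i <= 1.
Proof.
move=> xS; have := S_sphere xS; rewrite /dotp (bigD1 i)//= => h.
have : tnth x i * tnth x i <= 1.
  by rewrite -h lerDl; apply: sumr_ge0 => j _; rewrite -expr2 sqr_ge0.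
move=> ?; rewrite -ler_norml -(@ler_sqr _ `|_| 1) ?nnegrE//.
by rewrite expr1n real_normK ?num_real// expr2.
Qed.

Lemma tnth_barycenter_bounds y i : -1 <= tnth (barycenter y) i <= 1.
Proof.
rewrite tnth_mktuple -(sum_posterior lam S0 y) -sumrN !big_seq.
apply/andP; split; apply: ler_sum => x xS;
  have /andP[l u] := tnth_sphere i xS; have := posterior_ge0 lam S0 x y; nra.
Qed.

Let mB i : measurable_fun setT
  (fun w : n.-tuple R * n.-tuple R => tnth (barycenter (observation lam w)) i).
Proof.
apply: (measurableT_comp (@measurable_tnth _ R n i)).
apply: (measurableT_comp (measurable_barycenter lam S0)).
exact: measurable_observation.
Qed.

(** The Bayes formula on the events of the sigma-algebra of the observation. *)
Lemma integral_posterior_tower (phi : n.-tuple R -> R) (B : set (n.-tuple R)) :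
  measurable_fun setT phi -> (forall x, 0 <= phi x) -> measurable B ->
  (\int[model_law mu]_(w in @observation R n lam @^-1` B) (phi w.1)%:E =
   \int[model_law mu]_(w in @observation R n lam @^-1` B)
     (\sum_(x <- S) posterior x (observation lam w) * phi x)%:E)%E.
Proof.
move=> mphi phi0 mB'.
have mO := measurable_observation.
have mA : measurable ((@observation R n lam) @^-1` B).
  by rewrite -[X in measurable X]setTI; exact: mO.
have mi : measurable_fun setT (fun w => \1_B (observation lam w) : R).
  by apply: (measurableT_comp _ mO); exact: measurable_indic.
have E (F : n.-tuple R * n.-tuple R -> R) : measurable_fun setT F -> (forall w, 0 <= F w) ->
    (\int[model_law mu]_(w in @observation R n lam @^-1` B) (F w)%:E =
     (M^-1)%:E * \sum_(x <- S) \int[gamma]_z (F (x, z) * \1_B (obs x z))%:E)%E.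
  move=> mF F0; rewrite integral_mkcond.
  transitivity (\int[model_law mu]_w (F w * \1_B (observation lam w))%:E)%E.
    apply: eq_integral => w _; rewrite patchE indicE.
    by rewrite (_ : (w \in _) = (observation lam w \in B))//; case: ifP; rewrite ?mulr1 ?mulr0.
  rewrite ge0_integral_model_law//.
  - by under eq_bigr do under eq_integral do rewrite observationE.
  - by apply/measurable_EFinP; apply: measurable_funM.
  - by move=> w; rewrite lee_fin mulr_ge0.
rewrite !E; last 4 first.
- apply: measurable_sum => x; apply: measurable_funM => //.
  exact: (measurableT_comp (measurable_posterior lam S0 x) mO).
- by move=> w; apply: sumr_ge0 => x _; rewrite mulr_ge0 ?posterior_ge0.
- exact: (measurableT_comp mphi measurable_fst).
- by move=> w; exact: phi0.
congr (_ * _)%E.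
have := @posterior_tower R n S lam S0 S_sphere lam0 (fun x y => phi x * \1_B y).
move=> /= <-.
- apply: eq_bigr => x0 _; apply: eq_integral => z _; rewrite observationE/=.
  by rewrite big_distrl/=; congr (_%:E); apply: eq_bigr => x _; rewrite mulrA.
- by move=> x; apply: measurable_funM => //; exact: measurable_indic.
- by move=> x y; rewrite mulr_ge0.
Qed.

Lemma is_cond_exp_barycenter i :
  is_cond_exp (model_law mu) (sigma_of (observation lam))
    (fun w => tnth w.1 i) (fun w => tnth (barycenter (observation lam w)) i).
Proof.
have iB : (model_law mu).-integrable setT
    (EFin \o (fun w => tnth (barycenter (observation lam w)) i)).
  apply: measurable_bounded_integrable => //.
    by rewrite (@le_lt_trans _ _ 1%E) ?probability_le1 ?ltry.
  exists 1; split=> // a a1 w _ /=; rewrite ler_norml.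
  by have /andP[] := tnth_barycenter_bounds (observation lam w) i; lra.
split => //.
  move=> B mB'; exists ((fun y => tnth (barycenter y) i) @^-1` B); last by rewrite setTI.
  rewrite -[X in measurable X]setTI.
  apply: (measurableT_comp (@measurable_tnth _ R n i) (measurable_barycenter lam S0)) => //.
move=> _ [B mB' <-]; rewrite setTI.
set A := _ @^-1` B.
have mA : measurable A.
  by rewrite -[X in measurable X]setTI; exact: measurable_observation.
have mT := @measurable_tnth _ R n i.
have mabs : measurable_fun setT (fun x : n.-tuple R => `|tnth x i|).
  exact: measurableT_comp.
have mabsD : measurable_fun setT (fun x : n.-tuple R => tnth x i + `|tnth x i|).
  exact: measurable_funD.
have iX (F : n.-tuple R -> R) : measurable_fun setT F ->
    (model_law mu).-integrable A (fun w => (F w.1)%:E).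
  move=> mF; apply: (@integrableS _ _ _ _ setT) => //.
  have mF' : measurable_fun setT (fun w : n.-tuple R * n.-tuple R => F w.1).
    exact: (measurableT_comp mF measurable_fst).
  apply/integrableP; split; first exact/measurable_EFinP.
  rewrite ge0_integral_model_law//=; last first.
    by do 2 apply: measurableT_comp => //.
  under eq_bigr do rewrite integral_std_gaussian_cst.
  by rewrite sumEFin -EFinM ltry.
pose V w := \sum_(x <- S) posterior x (observation lam w) * `|tnth x i|.
have iV : (model_law mu).-integrable A (fun w => (V w)%:E).
  apply: (@integrableS _ _ _ _ setT) => //.
  apply: measurable_bounded_integrable => //.
  - by rewrite (@le_lt_trans _ _ 1%E) ?probability_le1 ?ltry.
  - apply: measurable_sum => x; apply: measurable_funM => //.
    exact: (measurableT_comp (measurable_posterior lam S0 x) measurable_observation).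
  exists 1; split=> // a a1 w _ /=; apply: le_trans (ltW a1).
  rewrite ger0_norm; last by apply: sumr_ge0 => x _; rewrite mulr_ge0 ?posterior_ge0.
  rewrite -(sum_posterior lam S0 (observation lam w)) /V !big_seq.
  apply: ler_sum => x xS; rewrite ler_piMr ?posterior_ge0//.
  by rewrite ler_norml; exact: tnth_sphere.
have e1 := integral_posterior_tower mabs (fun=> normr_ge0 _) mB'.
(* The Bayes formula is for nonnegative functions, while a coordinate is signed:
   it is applied to |u| and to u + |u|. *)
have e2 : (\int[model_law mu]_(w in A) (tnth w.1 i)%:E +
           \int[model_law mu]_(w in A) (`|tnth w.1 i|)%:E =
           \int[model_law mu]_(w in A) (tnth (barycenter (observation lam w)) i)%:E +
           \int[model_law mu]_(w in A) (V w)%:E)%E.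
  rewrite -integralD//; [|exact: (iX (fun x => tnth x i))|exact: (iX (fun x => `|tnth x i|))].
  rewrite -integralD//; last exact: integrableS iB.
  have := integral_posterior_tower mabsD _ mB'.
  rewrite -/A => /= h; under eq_integral do rewrite -EFinD.
  rewrite h; last by move=> x; have := ler_norm (- tnth x i); rewrite normrN; lra.
  apply: eq_integral => w _; rewrite -EFinD tnth_mktuple -big_split/=.
  by congr (_%:E); apply: eq_bigr => x _; rewrite mulrDr.
move: e2; rewrite e1 -/A -/V.
move=> /(congr1 (fun e => e - \int[model_law mu]_(w in A) (V w)%:E)%E).
have fV := integrable_fin_num mA iV.
by rewrite !addeK.
Qed.

Lemma posterior_mean_ae : \forall w \ae model_law mu,
  posterior_mean mu lam w = barycenter (observation lam w).
Proof.
have GS : sigma_algebra setT (sigma_of (@observation R n lam)).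
  by apply: sigma_algebra_preimage; exact: sigma_algebra_measurable.
have GM : sigma_of (@observation R n lam) `<=` measurable.
  by move=> _ [B mB1 <-]; exact: (measurable_observation measurableT mB1).
have h i : \forall w \ae model_law mu,
    tnth (posterior_mean mu lam w) i = tnth (barycenter (observation lam w)) i.
  have c := is_cond_exp_barycenter i.
  have c' := xgetPex (fun=> 0) (ex_intro _ _ c).
  have := cond_exp_unique GS GM c' c.
  by apply: filterS => w e; rewrite /posterior_mean tnth_mktuple; exact: e.
(* The exceptional sets of the coordinates are gathered by a countable union,
   indexed by nat rather than by 'I_n. *)
have : \forall w \ae model_law mu, forall k (i : 'I_n), i = k :> nat ->
    tnth (posterior_mean mu lam w) i = tnth (barycenter (observation lam w)) i.
  apply: ae_foralln => k; case: (ltnP k n) => kn.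
    apply: filterS (h (Ordinal kn)) => w hw i ik.
    by rewrite (_ : i = Ordinal kn)//; exact: val_inj.
  by apply: aeW => w i ik; have := ltn_ord i; rewrite ik ltnNge kn.
by apply: filterS => w hw; apply: eq_from_tnth => i; exact: hw.
Qed.

(** The posterior mean is almost surely the barycenter m of the posterior, and the
error is |x - m|^2 with |x| = 1. *)
Lemma mmseE : (mmse mu lam =
  (M^-1)%:E * \sum_(x <- S) \int[gamma]_z
    (1 - 2 * dotp x (barycenter (obs x z))
       + dotp (barycenter (obs x z)) (barycenter (obs x z)))%:E)%E.
Proof.
have mdotp2 (f g : n.-tuple R * n.-tuple R -> n.-tuple R) :
    measurable_fun setT f -> measurable_fun setT g ->
    measurable_fun setT (fun w => dotp (f w) (g w)).
  move=> mf mg; apply: measurable_sum => i; apply: measurable_funM.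
  - exact: (measurableT_comp (@measurable_tnth _ R n i) mf).
  - exact: (measurableT_comp (@measurable_tnth _ R n i) mg).
pose diff (y w : n.-tuple R) : n.-tuple R := [tuple tnth y i - tnth w i | i < n].
have diffE (x y : n.-tuple R) : enorm (diff x y) ^+ 2 = dotp x x - 2 * dotp x y + dotp y y.
  rewrite /enorm sqr_sqrtr ?dotp_ge0// /dotp big_distrr/= -sumrB -big_split/=.
  by apply: eq_bigr => i _; rewrite !tnth_mktuple; ring.
have mbar : measurable_fun setT (fun w : n.-tuple R * n.-tuple R => barycenter (observation lam w)).
  exact: (measurableT_comp (measurable_barycenter lam S0) measurable_observation).
have menorm (g : n.-tuple R * n.-tuple R -> n.-tuple R) : measurable_fun setT g ->
    measurable_fun setT (fun w => (enorm (diff w.1 (g w)) ^+ 2)%:E).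
  move=> mg; apply/measurable_EFinP.
  under eq_fun do rewrite diffE.
  apply: measurable_funD; last exact: mdotp2.
  by apply: measurable_funB; [|apply: measurable_funM => //]; exact: mdotp2.
have mpost : measurable_fun setT (posterior_mean mu lam).
  apply/measurable_fun_tnthP => i.
  have [+ _ _] := xgetPex (fun=> 0) (ex_intro _ _ (is_cond_exp_barycenter i)).
  move=> /(measurable_int _)/measurable_EFinP; apply: eq_measurable_fun => w _ /=.
  by rewrite /posterior_mean tnth_mktuple.
rewrite /mmse unlock.
transitivity (\int[model_law mu]_w
    (enorm (diff w.1 (barycenter (observation lam w))) ^+ 2)%:E)%E.
  apply: ae_eq_integral => //.
  - exact: menorm.
  - exact: menorm.
  - by apply: filterS posterior_mean_ae => w -> _.
rewrite ge0_integral_model_law//; last 2 first.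
- exact: menorm.
- by move=> w; rewrite lee_fin sqr_ge0.
congr (_ * _)%E; apply: eq_big_seq => x xS; apply: eq_integral => z _.
by rewrite diffE S_sphere// observationE.
Qed.

End mmse_formula.

(** * Control of the MMSE by the posterior mass of the overlaps *)

Section mmse_bounds.
Context {R : realType} {n : nat}.
Variables (S : {fset n.-tuple R}) (lam : R).
Hypothesis S0 : S != fset0.
Hypothesis S_sphere : forall x, x \in S -> dotp x x = 1.
Hypothesis lam0 : 0 <= lam.
Implicit Types x y z : n.-tuple R.

Local Notation mu := (uniform_prior S).
Local Notation gamma := (std_gaussian R n).
Local Notation posterior := (posterior S lam).
Local Notation barycenter := (posterior_barycenter S lam).
Local Notation obs := (obs lam).
Local Notation M := (#|` S|%:R : R).

Let M_gt0 : 0 < M. Proof. exact: cardfs_natr_gt0. Qed.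

(** The expectation over a signal uniform on S and an independent noise; the signal
is averaged by a finite sum, so that only integrals against the Gaussian law are
left. *)
Definition joint_mean (F : n.-tuple R -> n.-tuple R -> R) : \bar R :=
  ((M^-1)%:E * \sum_(x <- S) \int[gamma]_z (F x z)%:E)%E.

Let jm_ge0 (F : n.-tuple R -> n.-tuple R -> R) :
  (forall x z, x \in S -> 0 <= F x z) ->
  (0 <= \sum_(x <- S) \int[gamma]_z (F x z)%:E)%E.
Proof.
move=> F0; rewrite big_seq; apply: sume_ge0 => x xS.
by apply: integral_ge0 => z _; rewrite lee_fin F0.
Qed.

Lemma joint_mean_le (F G : n.-tuple R -> n.-tuple R -> R) :
  (forall x, measurable_fun setT (F x)) -> (forall x, measurable_fun setT (G x)) ->
  (forall x z, x \in S -> 0 <= F x z <= G x z) ->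
  (joint_mean F <= joint_mean G)%E.
Proof.
move=> mF mG FG; apply: lee_wpmul2l; first by rewrite lee_fin invr_ge0 ltW.
rewrite big_seq [leRHS]big_seq; apply: lee_sum => x xS.
apply: ge0_le_integral => //.
- by move=> z _; rewrite lee_fin; have /andP[] := FG x z xS.
- by apply/measurable_EFinP.
- by apply/measurable_EFinP.
- by move=> z _; rewrite lee_fin; have /andP[] := FG x z xS.
Qed.

Lemma joint_meanD (F G : n.-tuple R -> n.-tuple R -> R) :
  (forall x, measurable_fun setT (F x)) -> (forall x, measurable_fun setT (G x)) ->
  (forall x z, x \in S -> 0 <= F x z) -> (forall x z, x \in S -> 0 <= G x z) ->
  (joint_mean (fun x z => F x z + G x z)%R = joint_mean F + joint_mean G)%E.
Proof.
move=> mF mG F0 G0; rewrite /joint_mean -ge0_muleDr ?jm_ge0//.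
congr (_ * _)%E; rewrite -big_split/=; apply: eq_big_seq => x xS.
under eq_integral do rewrite EFinD.
rewrite ge0_integralD//.
- by move=> z _; rewrite lee_fin F0.
- by apply/measurable_EFinP.
- by move=> z _; rewrite lee_fin G0.
- by apply/measurable_EFinP.
Qed.

Lemma joint_meanZ k (F : n.-tuple R -> n.-tuple R -> R) : 0 <= k ->
  (forall x, measurable_fun setT (F x)) -> (forall x z, x \in S -> 0 <= F x z) ->
  joint_mean (fun x z => k * F x z) = (k%:E * joint_mean F)%E.
Proof.
move=> k0 mF F0; rewrite /joint_mean muleCA; congr (_ * _)%E.
rewrite big_seq [in RHS]big_seq ge0_sume_distrr; last first.
  by move=> x xS; apply: integral_ge0 => z _; rewrite lee_fin F0.
apply: eq_bigr => x xS; under eq_integral do rewrite EFinM.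
rewrite ge0_integralZl//.
- by apply/measurable_EFinP.
- by move=> z _; rewrite lee_fin F0.
Qed.

Lemma joint_mean_cst k : joint_mean (fun _ _ => k) = k%:E.
Proof.
rewrite /joint_mean; under eq_bigr do rewrite integral_std_gaussian_cst.
rewrite sumEFin -EFinM big_const_seq iter_addr addr0.
rewrite (_ : count _ _ = #|` S|); last by rewrite count_predT.
by rewrite -[k *+ _]mulr_natl mulKf// gt_eqF.
Qed.

(** The expected posterior probability that the overlap with the signal satisfies
Q. *)
Definition average_mass (Q : R -> bool) : \bar R :=
  joint_mean (fun x0 z =>
    \sum_(x <- S | Q (dotp x0 x)) posterior x (obs x0 z)).

Let mdotbar x0 : measurable_fun setT (fun z => dotp x0 (barycenter (obs x0 z))).
Proof.
apply: (measurableT_comp (measurable_dotp x0)).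
exact: (measurableT_comp (measurable_barycenter lam S0) (measurable_obs lam x0)).
Qed.

Let mpost x x0 : measurable_fun setT (fun z => posterior x (obs x0 z)).
Proof. exact: (measurableT_comp (measurable_posterior lam S0 x) (measurable_obs lam x0)). Qed.

Lemma measurable_posterior_mass (Q : R -> bool) x0 : measurable_fun setT
  (fun z => \sum_(x <- S | Q (dotp x0 x)) posterior x (obs x0 z)).
Proof.
under eq_fun do rewrite big_mkcond/=.
by apply: measurable_sum => x; case: (Q (dotp x0 x)).
Qed.

Let mmass := measurable_posterior_mass.

Lemma posterior_mass_ge0 (Q : R -> bool) x0 y :
  0 <= \sum_(x <- S | Q (dotp x0 x)) posterior x y.
Proof. by apply: sumr_ge0 => x _; exact: posterior_ge0. Qed.

Let mass_ge0 := posterior_mass_ge0.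

Let msq x0 : measurable_fun setT
  (fun z => dotp (barycenter (obs x0 z)) (barycenter (obs x0 z))).
Proof.
under eq_fun do rewrite sqnorm_barycenterE.
apply: measurable_sum => x; apply: measurable_funM => //.
apply: (measurableT_comp (measurable_dotp x)).
exact: (measurableT_comp (measurable_barycenter lam S0) (measurable_obs lam x0)).
Qed.

Let mmseJ : mmse mu lam = joint_mean (fun x z =>
  1 - 2 * dotp x (barycenter (obs x z))
    + dotp (barycenter (obs x z)) (barycenter (obs x z))).
Proof. exact: mmseE. Qed.

Let m_err x : measurable_fun setT (fun z =>
  1 - 2 * dotp x (barycenter (obs x z))
    + dotp (barycenter (obs x z)) (barycenter (obs x z))).
Proof.
apply: measurable_funD => //; apply: measurable_funB => //.
exact: measurable_funM.
Qed.

Let err_ge0 x y : x \in S ->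
  0 <= 1 - 2 * dotp x (barycenter y) + dotp (barycenter y) (barycenter y).
Proof.
move=> xS; have := dotp_ge0 (addt x (scalet (-1) (barycenter y))).
rewrite dotpDl !dotpDr !dotpZl !dotpZr S_sphere// (dotpC (barycenter y) x); lra.
Qed.

(** With m the posterior barycenter, E <X, m> = E |m|^2 by the Bayes formula, so the
MMSE is 1 - E |m|^2. *)
Lemma mmse_le1 : (mmse mu lam <= 1)%E.
Proof.
pose a x z := dotp x (barycenter (obs x z)).
pose b (x z : n.-tuple R) := dotp (barycenter (obs x z)) (barycenter (obs x z)).
pose K := joint_mean (fun x z => b x z + 1).
have b0 x z : 0 <= b x z by exact: dotp_ge0.
have b1 x z : b x z <= 1 by exact: sqnorm_barycenter_le1.
have mb x : measurable_fun setT (b x) by exact: msq.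
have ma x : measurable_fun setT (a x) by exact: mdotbar.
have a0 x z : x \in S -> 0 <= a x z + 1.
  by move=> xS; have := dotp_barycenter_geN1 lam S0 S_sphere (obs x z) xS; rewrite /a; lra.
have mb1 x : measurable_fun setT (fun z => b x z + 1) by apply: measurable_funD.
have ma1 x : measurable_fun setT (fun z => a x z + 1) by apply: measurable_funD.
(* Adding 1 to both integrands makes them nonnegative. *)
have aK : joint_mean (fun x z => a x z + 1) = K.
  rewrite /K /joint_mean; congr (_ * _)%E.
  have := @posterior_tower R n S lam S0 S_sphere lam0
    (fun x y => `|dotp x (barycenter y) + 1|).
  move=> /(_ _ (fun _ _ => normr_ge0 _)) h.
  transitivity (\sum_(x <- S) \int[gamma]_z (`|a x z + 1|)%:E)%E.
    apply: eq_big_seq => x xS; apply: eq_integral => z _.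
    by rewrite ger0_norm// a0.
  rewrite -h; last first.
    move=> x; apply: measurableT_comp => //; apply: measurable_funD => //.
    exact: (measurableT_comp (measurable_dotp x) (measurable_barycenter lam S0)).
  apply: eq_bigr => x0 _; apply: eq_integral => z _; congr (_%:E).
  rewrite /b sqnorm_barycenterE -[X in _ = _ + X](sum_posterior lam S0 (obs x0 z)) -big_split/=.
  apply: eq_big_seq => x xS; rewrite ger0_norm; first by rewrite mulrDr mulr1.
  by have := dotp_barycenter_geN1 lam S0 S_sphere (obs x0 z) xS; lra.
have K1 : (1 <= K)%E.
  rewrite -(joint_mean_cst 1); apply: joint_mean_le => // x z _.
  by have := b0 x z; lra.
have K2 : (K <= 2%:E)%E.
  rewrite -(joint_mean_cst 2); apply: joint_mean_le => // x z _.
  by have := b0 x z; have := b1 x z; lra.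
have sumE : (mmse mu lam + 2%:E * K = 2%:E + K)%E.
  rewrite mmseJ -{1}aK -joint_meanZ// -joint_meanD//; last 3 first.
  - by move=> x; apply: measurable_funM.
  - by move=> x z xS; exact: err_ge0.
  - by move=> x z xS; rewrite mulr_ge0// a0.
  rewrite -(joint_mean_cst 2) /K -joint_meanD//; last first.
    by move=> x z _; have := b0 x z; lra.
  congr joint_mean; apply/funext => x; apply/funext => z; rewrite /a /b; lra.
move: sumE K1 K2; case: (K) => [k| |]//.
case: (mmse mu lam) => [m| |]//.
rewrite -EFinM -!EFinD !lee_fin => -[]; lra.
Qed.

(** The error is at least 1 - 2 <x0, m>, and <x0, m> is the posterior mean of the
overlap: at most e, plus the mass of the overlaps at least e. *)
Lemma mmse_ge e : 0 <= e <= 1/2 ->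
  ((1 - 2 * e)%:E <= mmse mu lam + 2%:E * average_mass (fun t => (e <= t)%R))%E.
Proof.
move=> /andP[e0 e1].
rewrite mmseJ /average_mass -joint_meanZ// -joint_meanD//; last 3 first.
- by move=> x; apply: measurable_funM => //; exact: (mmass (fun t => e <= t)).
- by move=> x z xS; exact: err_ge0.
- by move=> x z _; rewrite mulr_ge0.
rewrite -(joint_mean_cst (1 - 2 * e)); apply: joint_mean_le => //.
  by move=> x; apply: measurable_funD => //; apply: measurable_funM => //;
    exact: (mmass (fun t => e <= t)).
move=> x0 z xS; apply/andP; split; first by lra.
have sq := dotp_ge0 (barycenter (obs x0 z)).
suff : dotp x0 (barycenter (obs x0 z)) <=
    e + \sum_(x <- S | e <= dotp x0 x) posterior x (obs x0 z) by lra.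
rewrite dotp_barycenter -[X in X + _]mulr1 -(sum_posterior lam S0 (obs x0 z)).
rewrite [X in _ + X]big_mkcond big_distrr/= -big_split/= !big_seq.
apply: ler_sum => x xS'; have p0 := posterior_ge0 lam S0 x (obs x0 z).
have t1 := dotp_le1 S_sphere xS xS'.
by case: (leP e (dotp x0 x)) => h; nra.
Qed.

(** Since |m| <= 1, the error is at most 2 (1 - <x0, m>), the posterior mean of
2 (1 - t) over the overlap t: at most 2 e, plus 4 times the mass of the overlaps
less than 1 - e. *)
Lemma mmse_le e : 0 <= e ->
  (mmse mu lam <= (2 * e)%:E + 4%:E * average_mass (fun t => (t < 1 - e)%R))%E.
Proof.
move=> e0; rewrite mmseJ /average_mass -joint_meanZ//; last 2 first.
- by move=> x; exact: (mmass (fun t => t < 1 - e)).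
- by move=> x z _; exact: (mass_ge0 (fun t => t < 1 - e)).
rewrite -(joint_mean_cst (2 * e)) -joint_meanD//; last 3 first.
- by move=> x; apply: measurable_funM => //; exact: (mmass (fun t => t < 1 - e)).
- by move=> x z _; rewrite mulr_ge0.
- by move=> x z _; apply: mulr_ge0 => //; exact: (mass_ge0 (fun t => t < 1 - e)).
apply: joint_mean_le => //.
  by move=> x; apply: measurable_funD => //; apply: measurable_funM => //;
    exact: (mmass (fun t => t < 1 - e)).
move=> x0 z xS; rewrite err_ge0//=.
have sq := sqnorm_barycenter_le1 lam S0 S_sphere (obs x0 z).
suff : 1 - dotp x0 (barycenter (obs x0 z)) <=
    e + 2 * \sum_(x <- S | dotp x0 x < 1 - e) posterior x (obs x0 z) by lra.
rewrite dotp_barycenter -[X in _ <= X + _]mulr1.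
rewrite -[X in X - _](sum_posterior lam S0 (obs x0 z)).
rewrite -[X in e * X](sum_posterior lam S0 (obs x0 z)).
rewrite [X in _ + _ * X]big_mkcond !big_distrr/= -sumrB -big_split/= !big_seq.
apply: ler_sum => x xS'; have p0 := posterior_ge0 lam S0 x (obs x0 z).
have tN1 := dotp_geN1 S_sphere xS xS'.
by case: (ltP (dotp x0 x)) => h; nra.
Qed.

End mmse_bounds.

(** * First-moment bounds on the posterior mass *)

(** The shift formula applied to a constant function. *)
Lemma integral_expR_dotp (R : realType) n (v : n.-tuple R) (c : R) :
  (\int[std_gaussian R n]_z (expR (dotp v z + c))%:E =
   (expR (c + dotp v v / 2))%:E)%E.
Proof.
have := @std_gaussian_shift R n v (cst 1%E) (measurable_cst _) (fun=> lee01).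
rewrite (integral_std_gaussian_cst n 1) => h.
rewrite -[RHS]mule1 h -ge0_integralZl//.
- apply: eq_integral => z _; rewrite mule1 -EFinM -expRD.
  by congr (expR _)%:E; ring.
- apply: emeasurable_funM => //; apply/measurable_EFinP.
  apply: measurableT_comp => //; apply: measurable_funB => //.
  exact: measurable_dotp.
- by move=> z _; rewrite mule1 lee_fin expR_ge0.
Qed.

(** A bound by both 1 and expR l is a bound by their geometric mean with weights
1 - theta and theta. This is the Chernoff step. *)
Lemma le_expR_interpolate (R : realType) (p l theta : R) :
  p <= 1 -> p <= expR l -> 0 <= theta <= 1 -> p <= expR (theta * l).
Proof.
move=> p1 pl /andP[t0 t1]; have [l0|l0] := leP 0 l.
  by apply: le_trans p1 _; rewrite -expR0 ler_expR mulr_ge0.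
by apply: le_trans pl _; rewrite ler_expR; nra.
Qed.

Section first_moment.
Context {R : realType} {n : nat}.
Variables (S : {fset n.-tuple R}) (lam : R).
Hypothesis S0 : S != fset0.
Hypothesis S_sphere : forall x, x \in S -> dotp x x = 1.
Hypothesis lam0 : 0 <= lam.
Implicit Types x y z : n.-tuple R.

Local Notation gamma := (std_gaussian R n).
Local Notation posterior := (posterior S lam).
Local Notation obs := (obs lam).
Local Notation M := (#|` S|%:R : R).
Local Notation sl := (Num.sqrt lam).

Let M_gt0 : 0 < M. Proof. exact: cardfs_natr_gt0. Qed.

(** With E = 0, the mean number of points whose overlap with a random point of S
satisfies Q; in general, each pair of overlap t has the weight expR (E t). *)
Definition pair_sum (Q : R -> bool) (E : R -> R) : R :=
  M^-1 * \sum_(x0 <- S) \sum_(x <- S | Q (dotp x0 x)) expR (E (dotp x0 x)).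

Let mlin x0 x (c t b : R) : measurable_fun setT
  (fun z => expR (c * (dotp x z - t * dotp x0 z) + b)).
Proof.
apply: measurableT_comp => //; apply: measurable_funD => //.
apply: measurable_funM => //; apply: measurable_funB; first exact: measurable_dotp.
by apply: measurable_funM => //; exact: measurable_dotp.
Qed.

Lemma measurable_pair_exp Q (c b : R -> R) x0 : measurable_fun setT (fun z =>
  \sum_(x <- S | Q (dotp x0 x))
     expR (c (dotp x0 x) * (dotp x z - dotp x0 x * dotp x0 z) + b (dotp x0 x))).
Proof.
under eq_fun do rewrite big_mkcond/=.
by apply: measurable_sum => x; case: (Q (dotp x0 x)).
Qed.

(** If x0 and x are unit vectors of overlap t, then x - t x0 has square norm
1 - t^2. Only this part of x, orthogonal to x0, enters the variance. *)
Lemma joint_mean_pair_exp Q (c b : R -> R) :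
  joint_mean S (fun x0 z => \sum_(x <- S | Q (dotp x0 x))
     expR (c (dotp x0 x) * (dotp x z - dotp x0 x * dotp x0 z) + b (dotp x0 x))) =
  (pair_sum Q (fun t => b t + c t ^+ 2 * (1 - t ^+ 2) / 2))%:E.
Proof.
rewrite /joint_mean /pair_sum EFinM; congr (_ * _)%E.
rewrite -sumEFin; apply: eq_big_seq => x0 x0S.
under eq_integral do rewrite -sumEFin big_mkcond/=.
rewrite ge0_integral_sum//; last 2 first.
- by move=> x; case: (Q (dotp x0 x)) => //; apply/measurable_EFinP.
- by move=> x z _; case: ifP => // _; rewrite lee_fin expR_ge0.
rewrite -sumEFin [RHS]big_mkcond/=; apply: eq_big_seq => x xS.
case: ifP => _; last by rewrite integral0.
pose t := dotp x0 x; rewrite -/t.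
pose v := scalet (c t) (addt x (scalet (- t) x0)).
under eq_integral => z _.
  rewrite (_ : c t * _ = dotp v z); last first.
    by rewrite /v dotpZl dotpDl dotpZl mulNr.
  over.
rewrite integral_expR_dotp; congr (expR (_ + _))%:E.
rewrite /v !dotpZl !dotpZr !dotpDl !dotpDr !dotpZl !dotpZr.
rewrite (S_sphere xS) (S_sphere x0S) (dotpC x x0) -/t; by field.
Qed.

Let tail_exp (c : R) (x0 : n.-tuple R) : measurable_fun setT
  (fun z => expR (c * dotp x0 z - c ^+ 2)).
Proof.
apply: measurableT_comp => //; apply: measurable_funB => //.
by apply: measurable_funM => //; exact: measurable_dotp.
Qed.

Let joint_mean_tail (c : R) :
  joint_mean S (fun x0 z => expR (c * dotp x0 z - c ^+ 2)) =
  (expR (- (c ^+ 2 / 2)))%:E.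
Proof.
rewrite -(joint_mean_cst S0) /joint_mean; congr (_ * _)%E.
apply: eq_big_seq => x0 x0S; rewrite integral_std_gaussian_cst.
under eq_integral do rewrite -dotpZl.
rewrite integral_expR_dotp dotpZl dotpZr S_sphere//.
by congr (expR _)%:E; field.
Qed.

Let dotp_obs x x0 z : dotp x (obs x0 z) = sl * dotp x0 x + dotp x z.
Proof. by rewrite dotpDr dotpZr (dotpC x x0). Qed.

Let sl2 : sl * sl = lam. Proof. by rewrite -expr2 sqr_sqrtr. Qed.

Let mmass := measurable_posterior_mass lam S0.

Let mass_ge0 := posterior_mass_ge0 lam S0.

Let mass_le1 Q x0 y : \sum_(x <- S | Q (dotp x0 x)) posterior x y <= 1.
Proof.
rewrite -(sum_posterior lam S0 y) big_mkcond; apply: ler_sum => x _.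
by case: ifP => // _; exact: posterior_ge0.
Qed.

Let pair_exp_ge0 Q (c b : R -> R) x0 z :
  0 <= \sum_(x <- S | Q (dotp x0 x))
     expR (c (dotp x0 x) * (dotp x z - dotp x0 x * dotp x0 z) + b (dotp x0 x)).
Proof. by apply: sumr_ge0 => x _; exact: expR_ge0. Qed.

(** The weight of x is at most 1 and at most its ratio to the weight of the signal
x0. The first term of the bound pays for the event <x0, z> <= - s; outside of it
the component of z along x0 contributes at most (1 - t) sqrt lam s to the
log-ratio. *)
Lemma average_mass_le_ratio (Q : R -> bool) (s : R) (theta : R -> R) : 0 <= s ->
  (forall t, -1 <= t <= 1 -> Q t -> 0 <= theta t <= 1) ->
  (average_mass S lam Q <=
   (expR (- (s ^+ 2 / 2)) + pair_sum Q (fun t =>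
      theta t * (1 - t) * (sl * s - lam) +
      (theta t * sl) ^+ 2 * (1 - t ^+ 2) / 2))%:E)%E.
Proof.
move=> s0 theta01.
pose b t := theta t * (1 - t) * (sl * s - lam).
have mP := measurable_pair_exp Q (fun t => theta t * sl) b.
have P0 := pair_exp_ge0 Q (fun t => theta t * sl) b.
rewrite EFinD -(joint_mean_pair_exp Q (fun t => theta t * sl) b).
have mT := tail_exp (- s); have := joint_mean_tail (- s).
rewrite sqrrN in mT *; move=> <-.
rewrite -joint_meanD//.
apply: joint_mean_le => //.
  by move=> x; apply: measurable_funD => //; exact: mP.
move=> x0 z x0S; rewrite mass_ge0/=.
(* On the exceptional event the mass is at most 1 <= expR (- s (<x0, z> + s)). *)
have [h|h] := leP (dotp x0 z) (- s).
  apply: le_trans (mass_le1 _ _ _) _; rewrite ler_wpDr//.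
  by rewrite -[X in X <= _]expR0 ler_expR; nra.
rewrite ler_wpDl ?expR_ge0//.
rewrite big_seq_cond [leRHS]big_seq_cond; apply: ler_sum => x /andP[xS Qx].
set t := dotp x0 x.
have tl : -1 <= t by exact: (dotp_geN1 S_sphere).
have tu : t <= 1 by exact: (dotp_le1 S_sphere).
have /theta01/(_ Qx)/andP[th0 th1] : -1 <= t <= 1 by rewrite tl tu.
(* An upper bound on the logarithm of the ratio of the weights of x and x0. *)
pose l := sl * (dotp x z - t * dotp x0 z) + (1 - t) * (sl * s - lam).
rewrite [X in expR X](_ : _ = theta t * l); last by rewrite /l /b; ring.
apply: le_expR_interpolate; rewrite ?th0//; first exact: posterior_le1.
apply: (@le_trans _ _ (likelihood lam x (obs x0 z) / likelihood lam x0 (obs x0 z))).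
  rewrite ler_pM2l ?likelihood_gt0// lef_pV2 ?posrE ?likelihood_gt0 ?partition_fun_gt0//.
  rewrite /partition_fun (big_fsetD1 x0)//= lerDl.
  by apply: sumr_ge0 => x' _; exact/ltW/likelihood_gt0.
rewrite /likelihood -expRN -expRD ler_expR !dotp_obs S_sphere// -/t /l.
have : 0 <= sl * ((1 - t) * (dotp x0 z + s)).
  by rewrite mulr_ge0 ?sqrtr_ge0// mulr_ge0//; lra.
move: (sl) sl2 => q <- hq; lra.
Qed.

(** The weight of x is compared with the threshold expR a for the normalizing sum.
The first term pays for the event that this sum is below the threshold, the
second one for the event s <= <x0, z>. *)
Lemma average_mass_le_threshold (Q : R -> bool) (s a : R) (theta : R -> R) : 0 <= s ->
  (forall t, -1 <= t <= 1 -> Q t -> 0 <= t /\ 0 <= theta t <= 1) ->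
  (average_mass S lam Q <=
   (expR a / M + (expR (- (s ^+ 2 / 2)) + pair_sum Q (fun t =>
      theta t * (lam * t - lam / 2 - a + sl * t * s) +
      (theta t * sl) ^+ 2 * (1 - t ^+ 2) / 2)))%:E)%E.
Proof.
move=> s0 theta01.
pose b t := theta t * (lam * t - lam / 2 - a + sl * t * s).
have mP := measurable_pair_exp Q (fun t => theta t * sl) b.
have P0 := pair_exp_ge0 Q (fun t => theta t * sl) b.
have jmZ : joint_mean S (fun x0 z => expR a * (partition_fun S lam (obs x0 z))^-1) = (expR a / M)%:E.
  rewrite joint_meanZ ?expR_ge0//.
  - by rewrite /joint_mean integral_inv_partition_fun// mule1.
  - move=> x; apply: (measurableT_comp (measurable_inv_partition_fun lam S0)).
    exact: measurable_obs.
  - by move=> x z _; rewrite invr_ge0 ltW// partition_fun_gt0.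
rewrite EFinD (EFinD (expR (- _))) -jmZ.
rewrite -(joint_mean_pair_exp Q (fun t => theta t * sl) b) -joint_mean_tail.
have mZ x : measurable_fun setT (fun z => expR a * (partition_fun S lam (obs x z))^-1).
  apply: measurable_funM => //.
  exact: (measurableT_comp (measurable_inv_partition_fun lam S0) (measurable_obs lam x)).
have Z0 x z : 0 <= expR a * (partition_fun S lam (obs x z))^-1.
  by rewrite mulr_ge0 ?expR_ge0// invr_ge0 ltW// partition_fun_gt0.
rewrite -joint_meanD//.
rewrite -joint_meanD//; last 2 first.
- by move=> x; apply: measurable_funD => //; exact: mP.
- by move=> x z _; rewrite addr_ge0 ?expR_ge0//; exact: P0.
apply: joint_mean_le => //.
  by move=> x; do 2 apply: measurable_funD => //; exact: mP.
move=> x0 z x0S; rewrite mass_ge0/=.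
set P := \sum_(x <- S | _) expR _.
have PP : 0 <= P by exact: P0.
have Zgt := partition_fun_gt0 lam S0 (obs x0 z).
(* The indicator of Z <= expR a is at most expR a / Z, of mean expR a / M. *)
have [hZ|hZ] := leP (partition_fun S lam (obs x0 z)) (expR a).
  apply: le_trans (mass_le1 _ _ _) _; rewrite ler_wpDr ?addr_ge0 ?expR_ge0//.
  by rewrite ler_pdivlMr// mul1r.
have [h|h] := leP s (dotp x0 z).
  apply: le_trans (mass_le1 _ _ _) _; rewrite ler_wpDl// ler_wpDr//.
  by rewrite -[X in X <= _]expR0 ler_expR; nra.
rewrite ler_wpDl// ler_wpDl ?expR_ge0//.
rewrite /P big_seq_cond [leRHS]big_seq_cond; apply: ler_sum => x /andP[xS Qx].
set t := dotp x0 x.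
have tl : -1 <= t by exact: (dotp_geN1 S_sphere).
have tu : t <= 1 by exact: (dotp_le1 S_sphere).
have /theta01/(_ Qx)[t0 /andP[th0 th1]] : -1 <= t <= 1 by rewrite tl tu.
(* An upper bound on the logarithm of likelihood x y / expR a. *)
pose l := sl * (dotp x z - t * dotp x0 z) + (lam * t - lam / 2 - a + sl * t * s).
rewrite [X in expR X](_ : _ = theta t * l); last by rewrite /l /b; ring.
apply: le_expR_interpolate; rewrite ?th0//; first exact: posterior_le1.
apply: (@le_trans _ _ (likelihood lam x (obs x0 z) / expR a)).
  by rewrite ler_pM2l ?likelihood_gt0// lef_pV2 ?posrE ?expR_gt0// ltW.
rewrite /likelihood -expRN -expRD ler_expR !dotp_obs -/t /l.
have : 0 <= sl * (t * (s - dotp x0 z)).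
  by rewrite mulr_ge0 ?sqrtr_ge0// mulr_ge0//; lra.
move: (sl) sl2 => q <- hq; lra.
Qed.

End first_moment.

(** * Pairs of points and their overlaps *)

Lemma limn_esup_lt_near (R : realType) (u : (\bar R)^nat) (l : \bar R) :
  (limn_esup u < l)%E -> \forall n \near \oo, (u n < l)%E.
Proof.
rewrite /limn_esup limf_esupE => /ereal_inf_lt[_ [A oA <-]] Al.
apply: filterS oA => n An; apply: le_lt_trans Al.
by apply: ereal_sup_ubound; exists n.
Qed.

Lemma near_forall_lt (P : nat -> nat -> Prop) :
  (forall k, \forall N \near \oo, P k N) ->
  forall K, \forall N \near \oo, forall k, (k < K)%N -> P k N.
Proof.
move=> h; elim=> [|K IH]; first by apply: nearW.
apply: filterS2 IH (h K) => N h1 h2 k; rewrite ltnS leq_eqVlt => /orP[/eqP->//|].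
exact: h1.
Qed.

Section pair_sum_theory.
Context {R : realType} {n : nat}.
Variable S : {fset n.-tuple R}.
Hypothesis S0 : S != fset0.
Hypothesis S_sphere : forall x, x \in S -> dotp x x = 1.
Local Notation M := (#|` S|%:R : R).

Let M_gt0 : 0 < M. Proof. exact: cardfs_natr_gt0. Qed.

Lemma pair_sum_split (A Q : R -> bool) E :
  pair_sum S Q E = pair_sum S (fun t => Q t && A t) E +
                   pair_sum S (fun t => Q t && ~~ A t) E.
Proof.
rewrite /pair_sum -mulrDr -big_split/=; congr (_ * _); apply: eq_bigr => x _.
by rewrite (bigID (fun y => A (dotp x y))).
Qed.

Lemma ler_pair_sum (Q Q' : R -> bool) E F :
  (forall t, -1 <= t <= 1 -> Q t -> Q' t /\ E t <= F t) ->
  pair_sum S Q E <= pair_sum S Q' F.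
Proof.
move=> EF; rewrite /pair_sum ler_pM2l ?invr_gt0// !big_seq.
apply: ler_sum => x xS; rewrite big_seq_cond [leRHS]big_seq_cond.
rewrite big_mkcond [leRHS]big_mkcond.
apply: ler_sum => y _; case: (boolP (y \in S)) => //= yS.
have tI : -1 <= dotp x y <= 1.
  by rewrite (dotp_geN1 S_sphere)// (dotp_le1 S_sphere).
case: ifP => [/(EF _ tI)[-> EF']|_]; first by rewrite ler_expR.
by case: ifP => // _; exact: expR_ge0.
Qed.

Lemma pair_sum_cst (Q : R -> bool) e :
  pair_sum S Q (fun=> e) = expR e * pair_sum S Q (fun=> 0).
Proof.
rewrite /pair_sum mulrCA; congr (_ * _); rewrite big_distrr/=.
apply: eq_bigr => x _; rewrite big_distrr/=; apply: eq_bigr => y _.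
by rewrite expR0 mulr1.
Qed.

Lemma pair_sum0_le (Q : R -> bool) : pair_sum S Q (fun=> 0) <= M.
Proof.
rewrite /pair_sum ler_pdivrMl//.
apply: (@le_trans _ _ (\sum_(x <- S) \sum_(y <- S) 1)).
  apply: ler_sum => x _; rewrite big_mkcond/=; apply: ler_sum => y _.
  by rewrite expR0; case: ifP.
have sumS (c : R) : \sum_(x <- S) c = M * c.
  by rewrite big_const_seq iter_addr addr0 count_predT -[c *+ _]mulr_natl.
by rewrite !sumS mulr1.
Qed.

Lemma pair_sum_overlap (t : R) :
  (uniform_prior S \x uniform_prior S)%E [set p | (t <= dotp p.1 p.2)%R] =
  (M^-1 * pair_sum S (fun u => t <= u) (fun=> 0))%:E.
Proof.
rewrite uniform_prior_prod//; last first.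
  have mD : measurable_fun setT (fun p : n.-tuple R * n.-tuple R => dotp p.1 p.2).
    apply: measurable_sum => i; apply: measurable_funM.
    - exact: (measurableT_comp (@measurable_tnth _ R n i) measurable_fst).
    - exact: (measurableT_comp (@measurable_tnth _ R n i) measurable_snd).
  have := mD measurableT `[t, +oo[%classic (measurable_itv _).
  rewrite setTI; congr (measurable _).
  by apply/seteqP; split => p /=; rewrite in_itv/= andbT.
congr (_%:E); rewrite /pair_sum mulrA -invfM mulrC -expr2; congr (_ * _).
apply: eq_bigr => x _; rewrite [RHS]big_mkcond/=; apply: eq_bigr => y _.
rewrite expR0 (_ : ((x, y) \in _) = (t <= dotp x y)); first by case: ifP.
by apply/idP/idP => [/set_mem|h]//; apply/mem_set.
Qed.

(** Each pair is put in a bin [tau, tau + 1 / (K + 1)] of its overlap. In the bin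
the exponent is at most its value at tau plus a Lipschitz error, and the pairs of
the bin are among those of overlap at least tau, which is what a bound on the
tails of the overlap controls. *)
Lemma pair_sum_grid (L p w a b : R) (K : nat) :
  0 <= L -> 0 <= p -> 0 <= w -> 0 <= a -> b <= 1 ->
  pair_sum S (fun t => a <= t <= b) (fun t => L * ((p * t - w) / (1 + t))) <=
  \sum_(k < K.+1) (if a + k%:R / K.+1%:R <= b then
    expR (L * ((p * (a + k%:R / K.+1%:R) - w) / (1 + (a + k%:R / K.+1%:R)) + (p + w) / K.+1%:R))
    * pair_sum S (fun t => a + k%:R / K.+1%:R <= t) (fun=> 0) else 0).
Proof.
move=> L0 p0 w0 a0 b1.
have K0 : 0 < K.+1%:R :> R by rewrite ltr0n.
pose tk k : R := a + k%:R / K.+1%:R.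
pose g t := (p * t - w) / (1 + t).
have gLip s t : 0 <= s -> s <= t -> g t <= g s + (p + w) * (t - s).
  move=> s0 st; have t0 := le_trans s0 st.
  have s1 : 0 < 1 + s by lra.
  have t1 : 0 < 1 + t by lra.
  rewrite -lerBlDl (_ : g t - g s = (p + w) * (t - s) / ((1 + s) * (1 + t))); last first.
    by rewrite /g; field; rewrite !gt_eqF.
  rewrite ler_pdivrMr ?mulr_gt0// ler_peMr//; last by nra.
  by apply: mulr_ge0; lra.
have bin t : a <= t <= b -> exists2 k : 'I_K.+1, tk k <= t & t <= tk k + K.+1%:R^-1.
  move=> /andP[at_ tb].
  have x0 : 0 <= (t - a) * K.+1%:R by apply: mulr_ge0; lra.
  have /andP[l u] := truncn_itv x0.
  set k := Num.truncn _ in l u.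
  have [kK|kK] := ltnP k K.+1.
    exists (Ordinal kK); rewrite /tk/=.
      by rewrite -lerBrDl ler_pdivrMr.
    rewrite -addrA -lerBlDl -{2}[K.+1%:R^-1]mul1r -mulrDl -natr1.
    by rewrite ler_pdivlMr ?natr1 // ltW.
  (* The bins cover [a, a + 1], which contains [a, b]; the right end a + 1 is in
     the last one. *)
  exists ord_max; rewrite /tk/=.
    rewrite -lerBrDl ler_pdivrMr//; apply: le_trans l.
    by rewrite ler_nat (leq_trans _ kK).
  rewrite -addrA -{2}[K.+1%:R^-1]mul1r -mulrDl natr1 divff ?gt_eqF//; lra.
rewrite /pair_sum.
rewrite [leRHS](_ : _ = M^-1 * \sum_(x0 <- S) \sum_(x <- S) \sum_(k < K.+1)
   (if (tk k <= b) && (tk k <= dotp x0 x) then expR (L * (g (tk k) + (p + w) / K.+1%:R)) else 0)).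
  rewrite ler_pM2l ?invr_gt0//; apply: ler_sum => x0 _.
  rewrite big_mkcond/=; apply: ler_sum => x _.
  have term_ge0 k : 0 <= (if (tk k <= b) && (tk k <= dotp x0 x) then
      expR (L * (g (tk k) + (p + w) / K.+1%:R)) else 0).
    by case: ifP => // _; exact: expR_ge0.
  case: ifP => [h|_]; last by apply: sumr_ge0.
  have [k kl ku] := bin _ h.
  rewrite (bigD1 k)//=; apply: ler_wpDr; first by apply: sumr_ge0.
  have /andP[h1 h2] := h.
  rewrite kl (le_trans kl h2)/= ler_expR ler_wpM2l//.
  have tk0 : 0 <= tk k by rewrite /tk addr_ge0// divr_ge0// ltW.
  apply: (le_trans (gLip _ _ tk0 kl)); rewrite lerD2l ler_wpM2l ?addr_ge0//.
  by rewrite lerBlDl.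
rewrite [X in _ = _ * X](eq_bigr _ (fun x _ => exchange_big _ _ _ _ _ _)) /=.
rewrite exchange_big/= big_distrr/=; apply: eq_bigr => k _.
rewrite -/(tk k) -/(g (tk k)); case: (tk k <= b) => /=; last first.
  by rewrite big1 ?mulr0// => x _; rewrite big1.
rewrite mulrCA big_distrr/=; congr (_ * _); apply: eq_bigr => x _.
rewrite big_distrr/= [LHS]big_mkcond/=; apply: eq_bigr => y _.
by case: ifP => // _; rewrite expR0 mulr1.
Qed.

End pair_sum_theory.

(** * Large dimension *)

Section asymptotics.
Context {R : realType}.
Variables (S : forall N : nat, {fset N.-tuple R}) (r : R -> R).
Hypothesis S_neq0 : forall N, (0 < N)%N -> S N != fset0.
Hypothesis S_sphere : forall N (x : N.-tuple R), x \in S N -> enorm x = 1.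
Hypothesis card_S : #|` S N| @[N --> \oo] --> \oo.
Hypothesis r_overlap : overlap_rate_function (fun N => uniform_prior (S N))
                   (fun N => #|` S N|) r.
Hypothesis r_lower : forall t : R, 0 <= t <= 1 -> 2 * t / (1 + t) <= r t.

Let L N : R := ln (#|` S N|%:R).

Let sphere N (x : N.-tuple R) : x \in S N -> dotp x x = 1.
Proof. by move=> /S_sphere; exact: dotp_enorm1. Qed.

Lemma log_card_large (A : R) : \forall N \near \oo, A <= L N.
Proof.
have : \forall N \near \oo, ((Num.truncn (expR A)).+1 <= #|` S N|)%N.
  exact: (card_S (nbhs_infty_ge _)).
apply: filterS => N h; rewrite -[A]expRK ler_ln ?posrE ?expR_gt0//.
  apply: ltW; apply: lt_le_trans (truncnS_gt _) _; by rewrite ler_nat.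
by rewrite ltr0n; exact: leq_trans h.
Qed.

Lemma expR_log_card_vanish (c e : R) : 0 < c -> 0 < e ->
  \forall N \near \oo, expR (- (c * L N)) <= e.
Proof.
move=> c0 e0; apply: filterS (log_card_large (- ln e / c)) => N h.
rewrite -[leRHS]lnK ?posrE// ler_expR.
by rewrite lerNl -ler_pdivrMl// mulrC.
Qed.

Let nonempty_near : \forall N \near \oo, (0 < N)%N.
Proof. by exists 1%N. Qed.

Let cardE N : S N != fset0 -> #|` S N|%:R = expR (L N) :> R.
Proof. by move=> h; rewrite /L lnK// posrE cardfs_natr_gt0. Qed.

(** The overlap rate function bounds a probability for two independent points; with
M^2 pairs, averaged over one of the points, this is a mean number of points. *)
Lemma overlap_pairs (t d : R) : -1 <= t <= 1 -> 0 < d ->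
  \forall N \near \oo, pair_sum (S N) (fun u => t <= u) (fun=> 0)
     <= expR (L N * (1 - r t + d)).
Proof.
move=> tI d0; have [_ _ /(_ t)] := r_overlap.
rewrite in_itv/= => /(_ tI) h.
have : (limn_esup (fun N => (ln (#|` S N|)%:R)^-1%:E *
    lne ((uniform_prior (S N) \x uniform_prior (S N)) [set p | (t <= dotp p.1 p.2)%R]))
    < (- r t + d)%:E)%E.
  by apply: le_lt_trans h _; rewrite lte_fin ltrDl.
move=> /limn_esup_lt_near h1.
apply: filterS3 nonempty_near (log_card_large 1) h1 => N /S_neq0 SN L1.
rewrite pair_sum_overlap// cardE//.
set ps := pair_sum _ _ _.
have L0 : 0 < L N by lra.
have [ps0|ps0] := leP ps 0; first by rewrite (le_trans ps0)// expR_ge0.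
have P0 : 0 < (expR (L N))^-1 * ps by rewrite mulr_gt0 ?invr_gt0 ?expR_gt0.
rewrite (lne_EFin P0) -EFinM lte_fin.
rewrite lnM ?posrE ?invr_gt0 ?expR_gt0// -expRN !expRK ltr_pdivrMl// => h2.
by rewrite -[ps]lnK ?posrE// ler_expR; lra.
Qed.

(** Where r >= 2 t / (1 + t) enters: there are on average about
M^(1 - r t) <= M^((1 - t) / (1 + t)) points of overlap t, each weighted by
M^((p t - w) / (1 + t)), and the hypothesis makes the sum of both exponents
negative on [a, b]. *)
Lemma pair_sum_vanish (p w a b c e : R) : 0 <= p -> 0 <= w -> 0 <= a -> b <= 1 ->
  0 < c -> 0 < e ->
  (forall t, a <= t <= b -> p * t - w + (1 - t) <= - c) ->
  \forall N \near \oo, pair_sum (S N) (fun t => a <= t <= b)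
    (fun t => L N * ((p * t - w) / (1 + t))) <= e.
Proof.
move=> p0 w0 a0 b1 c0 e0 H.
(* The mesh is so fine that the Lipschitz error in the exponent is at most c / 8.
   Another c / 8 is lost in overlap_pairs, out of the c / 2 available. *)
pose K := Num.truncn ((p + w) / (c / 8)).
have K0 : 0 < K.+1%:R :> R by rewrite ltr0n.
have hK : (p + w) / K.+1%:R <= c / 8.
  rewrite ler_pdivrMr// mulrC -ler_pdivrMr; last lra.
  exact/ltW/truncnS_gt.
pose tk k : R := a + k%:R / K.+1%:R.
have tk0 k : 0 <= tk k by rewrite /tk addr_ge0// divr_ge0// ltW.
have h : \forall N \near \oo, forall k, (k < K.+1)%N -> tk k <= b ->
    pair_sum (S N) (fun u => tk k <= u) (fun=> 0) <=
    expR (L N * (1 - r (tk k) + c / 8)).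
  apply: near_forall_lt => k.
  have [kb|kb] := leP (tk k) b; last by apply: nearW.
  have tI : -1 <= tk k <= 1 by have := tk0 k; lra.
  have c8 : 0 < c / 8 by lra.
  by apply: filterS (overlap_pairs tI c8).
have c4 : 0 < c / 4 by lra.
have eK : 0 < e / K.+1%:R by rewrite divr_gt0.
apply: filterS2 (filterI nonempty_near (log_card_large 0))
  (filterI h (expR_log_card_vanish c4 eK)).
move=> N [/S_neq0 SN L0] [hN hv].
apply: le_trans (pair_sum_grid SN K L0 p0 w0 a0 b1) _.
apply: (@le_trans _ _ (\sum_(k < K.+1) (e / K.+1%:R))); last first.
  by rewrite sumr_const card_ord -[_ *+ _]mulr_natr divfK// gt_eqF.
apply: ler_sum => k _; rewrite -/(tk k).
case: ifP => kb; last exact: ltW.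
apply: le_trans (ler_wpM2l (expR_ge0 _) (hN k (ltn_ord k) kb)) _.
rewrite -expRD; apply: le_trans hv; rewrite ler_expR.
have t1 : tk k <= 1 by lra.
have rl : 2 * tk k / (1 + tk k) <= r (tk k) by apply: r_lower; rewrite tk0.
have := H (tk k); rewrite {1}/tk lerDl divr_ge0 ?(ltW K0)// kb => /(_ isT) Hk.
have t0 := tk0 k.
have key : (p * tk k - w) / (1 + tk k) + 1 - 2 * tk k / (1 + tk k) <= - (c / 2).
  rewrite (_ : _ - _ = (p * tk k - w + (1 - tk k)) / (1 + tk k)); last first.
    by field; rewrite gt_eqF//; lra.
  by rewrite ler_pdivrMr; [nra|lra].
have -> : - (c / 4 * L N) = L N * - (c / 4) by ring.
rewrite -mulrDr ler_wpM2l//; move: key rl hK.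
move: (_ / (1 + tk k)) (2 * tk k / (1 + tk k)) (_ / K.+1%:R) => X Y Z; lra.
Qed.

Let snr_scale (q d l : R) : 0 <= q -> 0 <= l ->
  Num.sqrt (q * l) * (d * Num.sqrt l) = Num.sqrt q * d * l.
Proof.
by move=> q0 l0; rewrite sqrtrM// -[X in _ = _ * X](sqr_sqrtr l0); ring.
Qed.

(** The power theta = 1 / (1 + t) minimizes the exponent of average_mass_le_ratio at
s = 0. For t < 0 it exceeds 1 and is replaced by 1, which suffices because then
all M points may be counted. *)
Lemma average_mass_vanish_above (beta eps e : R) :
  1 < beta -> 0 < eps <= 1 -> 0 < e ->
  \forall N \near \oo,
    (average_mass (S N) (beta * (2 * L N)) (fun t => (t < 1 - eps)%R) <= e%:E)%E.
Proof.
move=> b1 /andP[eps0 eps1] e0.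
pose q := Num.sqrt (beta * 2).
have q0 : 0 < q by rewrite sqrtr_gt0; lra.
(* The truncation level is s = d sqrt L: large enough for the exceptional event
   to have vanishing probability, while sqrt lam s = q d L changes the exponents
   by half of the gap beta - 1. *)
pose d := (beta - 1) / (2 * q).
have qd : q * d = (beta - 1) / 2 by rewrite /d; field; rewrite gt_eqF.
have d0 : 0 < d by rewrite divr_gt0 ?mulr_gt0//; lra.
(* For t >= 0 the exponent is then - m (1 - t) / (1 + t) times L, with
   m = beta - q d > 1. *)
pose m := (beta + 1) / 2.
pose theta (t : R) := if t < 0 then 1 else (1 + t)^-1.
have theta01 t : -1 <= t <= 1 -> t < 1 - eps -> 0 <= theta t <= 1.
  move=> _ _; rewrite /theta; case: (ltP t 0) => t0; first by rewrite ler01 lexx.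
  by rewrite invr_ge0 invf_le1; lra.
have d2 : 0 < d ^+ 2 / 2 by rewrite divr_gt0// exprn_gt0.
have m1 : 0 < m - 1 by rewrite /m; lra.
have e3 : 0 < e / 3 by lra.
have m0 : 0 <= m by lra.
have c0 : 0 < (m - 1) * eps by rewrite mulr_gt0.
have eb : 1 - eps <= 1 by lra.
have hc t : 0 <= t <= 1 - eps -> m * t - m + (1 - t) <= - ((m - 1) * eps).
  by move=> /andP[t0 t1]; nra.
apply: filterS3 (filterI nonempty_near (log_card_large 0))
  (filterI (expR_log_card_vanish d2 e3) (expR_log_card_vanish m1 e3))
  (pair_sum_vanish m0 m0 (lexx 0) eb c0 e3 hc).
move=> N [/S_neq0 SN L0] [h1 h2] h3.
set lam := beta * (2 * L N).
have lam0 : 0 <= lam by rewrite /lam mulr_ge0; lra.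
pose s := d * Num.sqrt (L N).
have s0 : 0 <= s by rewrite mulr_ge0 ?sqrtr_ge0// ltW.
have sls : Num.sqrt lam * s = (beta - 1) / 2 * L N.
  rewrite /lam /s mulrA snr_scale//; last lra.
  by rewrite -/q qd.
have sl2 : Num.sqrt lam ^+ 2 = lam by rewrite sqr_sqrtr.
have s2 : s ^+ 2 = d ^+ 2 * L N by rewrite /s exprMn sqr_sqrtr.
apply: le_trans (average_mass_le_ratio SN (@sphere N) lam0 s0 theta01) _.
rewrite lee_fin s2 (pair_sum_split _ (fun t => t < 0)).
rewrite (_ : d ^+ 2 * L N / 2 = d ^+ 2 / 2 * L N); last by ring.
set A := pair_sum _ _ _; set B := pair_sum _ _ _.
have hA : A <= e / 3.
  apply: (@le_trans _ _ (pair_sum (S N) (fun t => (t < 1 - eps) && (t < 0))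
      (fun=> - (m * L N)))).
    apply: (ler_pair_sum SN (@sphere N)) => t /andP[tl tu] /andP[Qt t0].
    split; first by rewrite /= Qt t0.
    rewrite /theta t0 !mul1r sl2 sls /lam /m.
    have : 0 <= L N * (- t) by rewrite mulr_ge0//; lra.
    have : 0 <= L N * t ^+ 2 by rewrite mulr_ge0// sqr_ge0.
    nra.
  rewrite pair_sum_cst; apply: le_trans (ler_wpM2l (expR_ge0 _) (pair_sum0_le SN _)) _.
  rewrite cardE// -expRD; apply: le_trans h2; rewrite ler_expR; lra.
have hB : B <= e / 3.
  apply: le_trans h3; apply: (ler_pair_sum SN (@sphere N)) => t /andP[tl tu] /andP[Qt].
  rewrite -leNgt => t0; split; first by rewrite t0 ltW.
  have t1 : 1 + t != 0 by rewrite gt_eqF//; lra.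
  rewrite /theta ltNge t0/= exprMn sl2 sls /lam /m le_eqVlt; apply/orP; left; apply/eqP.
  by field.
lra.
Qed.

(** The exponent of average_mass_le_threshold with theta = 1 / (1 + t) and threshold
M^(1 - k) is L (p t - (1 - k)) / (1 + t), where p < 1 is beta up to the
truncation error. *)
Lemma average_mass_vanish_below (beta eps e : R) :
  0 <= beta < 1 -> 0 < eps <= 1 -> 0 < e ->
  \forall N \near \oo,
    (average_mass (S N) (beta * (2 * L N)) (fun t => (eps <= t)%R) <= e%:E)%E.
Proof.
move=> /andP[b0 b1] /andP[eps0 eps1] e0.
pose q := Num.sqrt (beta * 2).
have q0 : 0 <= q by exact: sqrtr_ge0.
(* The denominator q + 1 covers the case beta = 0, where q = 0. *)
pose d := (1 - beta) / (2 * (q + 1)).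
have d0 : 0 < d by rewrite divr_gt0 ?mulr_gt0//; lra.
have qd : q * d <= (1 - beta) / 2.
  rewrite /d mulrA ler_pdivrMr; last lra.
  by rewrite mulrC -subr_ge0 (_ : _ - _ = 1 - beta); [lra|field].
have qd0 : 0 <= q * d by rewrite mulr_ge0// ltW.
(* The total exponent k - (1 - p) t is at most k - (1 - beta) eps / 2 = - k. *)
pose k := (1 - beta) * eps / 4.
have k0 : 0 < k by rewrite divr_gt0// mulr_gt0//; lra.
have k1 : k <= 1 by rewrite /k; nra.
pose p := beta + q * d.
have p0 : 0 <= p by rewrite addr_ge0.
have w0 : 0 <= 1 - k by lra.
pose theta (t : R) := (1 + t)^-1.
have theta01 t : -1 <= t <= 1 -> eps <= t -> 0 <= t /\ 0 <= theta t <= 1.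
  move=> _ et; split; first lra.
  by rewrite /theta invr_ge0 invf_le1; lra.
have d2 : 0 < d ^+ 2 / 2 by rewrite divr_gt0// exprn_gt0.
have e3 : 0 < e / 3 by lra.
have hc t : eps <= t <= 1 -> p * t - (1 - k) + (1 - t) <= - k.
  move=> /andP[t0 t1]; rewrite /p /k; nra.
apply: filterS3 (filterI nonempty_near (log_card_large 0))
  (filterI (expR_log_card_vanish d2 e3) (expR_log_card_vanish k0 e3))
  (pair_sum_vanish p0 w0 (ltW eps0) (lexx 1) k0 e3 hc).
move=> N [/S_neq0 SN L0] [h1 h2] h3.
set lam := beta * (2 * L N).
have lam0 : 0 <= lam by rewrite /lam mulr_ge0; lra.
pose s := d * Num.sqrt (L N).
have s0 : 0 <= s by rewrite mulr_ge0 ?sqrtr_ge0// ltW.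
have sls : Num.sqrt lam * s = q * d * L N.
  by rewrite /lam /s mulrA snr_scale//; lra.
have sl2 : Num.sqrt lam ^+ 2 = lam by rewrite sqr_sqrtr.
have s2 : s ^+ 2 = d ^+ 2 * L N by rewrite /s exprMn sqr_sqrtr.
apply: le_trans (average_mass_le_threshold SN (@sphere N) lam0 ((1 - k) * L N) s0 theta01) _.
rewrite lee_fin s2 cardE// -expRN -expRD.
rewrite (_ : d ^+ 2 * L N / 2 = d ^+ 2 / 2 * L N); last by ring.
rewrite (_ : (1 - k) * L N + - L N = - (k * L N)); last by ring.
set B := pair_sum _ _ _.
have hB : B <= e / 3.
  apply: le_trans h3; apply: (ler_pair_sum SN (@sphere N)) => t /andP[tl tu] Qt.
  split; first by rewrite Qt.
  have t1 : 1 + t != 0 by rewrite gt_eqF//; lra.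
  rewrite /theta exprMn sl2 (mulrAC _ t s) sls /lam /p le_eqVlt; apply/orP; left; apply/eqP.
  by field.
lra.
Qed.

End asymptotics.

Lemma cvge_of_eps (R : realType) (u : nat -> \bar R) (l : R) :
  (forall e, 0 < e ->
    \forall N \near \oo, ((l - e)%:E <= u N)%E /\ (u N <= (l + e)%:E)%E) ->
  u N @[N --> \oo] --> l%:E.
Proof.
move=> h; apply/fine_cvgP; split.
  apply: filterS (h 1 ltr01) => N [].
  by case: (u N).
apply/cvgrPdist_le => e e0; apply: filterS (h e e0) => N /= [].
case: (u N) => [v| |]//=; rewrite !lee_fin => h1 h2.
by rewrite ler_distl; lra.
Qed.

Theorem theorem2 (R : realType) (S : forall N : nat, {fset N.-tuple R})
    (r : R -> R)
    (S_neq0 : forall N, (0 < N)%N -> S N != fset0)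
    (S_sphere : forall N (x : N.-tuple R), x \in S N -> enorm x = 1)
    (card_S : #|` S N| @[N --> \oo] --> \oo)
    (r_overlap : overlap_rate_function (fun N => uniform_prior (S N))
                   (fun N => #|` S N|) r)
    (r_lower : forall t : R, 0 <= t <= 1 -> 2 * t / (1 + t) <= r t) :
  all_or_nothing (fun N => uniform_prior (S N))
    (fun N => 2 * ln (#|` S N|%:R)).
Proof.
move=> beta b0 b1.
have sphere N (x : N.-tuple R) : x \in S N -> dotp x x = 1.
  by move=> /S_sphere; exact: dotp_enorm1.
have near0 : \forall N \near \oo,
    S N != fset0 /\ 0 <= beta * (2 * ln (#|` S N|%:R : R)).
  have n0 : \forall N \near \oo, (0 < N)%N by exists 1%N.
  apply: filterS2 n0 (log_card_large card_S 0) => N N0 L0.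
  by split; [exact: S_neq0|rewrite !mulr_ge0].
have [bl|bg] := ltP beta 1.
  apply: cvge_of_eps => e e0.
  pose eps : R := Num.min (e / 4) (1 / 2).
  have eps0 : 0 < eps by rewrite lt_min; apply/andP; split; lra.
  have eps1 : eps <= 1 / 2 by rewrite ge_min lexx orbT.
  have epse : eps <= e / 4 by rewrite ge_min lexx.
  have e4 : 0 < e / 4 by lra.
  have bI : 0 <= beta < 1 by rewrite b0 bl.
  have epsI : 0 < eps <= 1 by rewrite eps0/=; lra.
  apply: filterS2 near0 (average_mass_vanish_below S_neq0 S_sphere card_S
    r_overlap r_lower bI epsI e4).
  move=> N [SN lam0] mass.
  have m1 := mmse_le1 SN (@sphere N) lam0.
  split; last by apply: le_trans m1 _; rewrite lee_fin; lra.
  have epsJ : 0 <= eps <= 1 / 2 by lra.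
  apply: (@le_trans _ _ ((1 - 2 * eps)%:E - (2 * (e / 4))%:E)%E).
    by rewrite -EFinB lee_fin; lra.
  rewrite leeBlDr//; apply: le_trans (mmse_ge SN (@sphere N) lam0 epsJ) _.
  by rewrite leeD2l// EFinM lee_wpmul2l// lee_fin.
have {}b1 : 1 < beta by rewrite lt_neqAle eq_sym b1.
apply: cvge_of_eps => e e0.
pose eps : R := Num.min (e / 4) 1.
have eps0 : 0 < eps by rewrite lt_min ltr01 andbT; lra.
have eps1 : eps <= 1 by rewrite ge_min lexx orbT.
have epse : eps <= e / 4 by rewrite ge_min lexx.
have e8 : 0 < e / 8 by lra.
have epsI : 0 < eps <= 1 by rewrite eps0.
apply: filterS2 near0 (average_mass_vanish_above S_neq0 S_sphere card_S
  r_overlap r_lower b1 epsI e8).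
move=> N [SN lam0] mass; split.
  apply: (@le_trans _ _ 0%E); first by rewrite lee_fin; lra.
  by apply: expectation_ge0 => w; exact: sqr_ge0.
apply: le_trans (mmse_le SN (@sphere N) lam0 (ltW eps0)) _.
apply: (@le_trans _ _ ((2 * eps)%:E + 4%:E * (e / 8)%:E)%E).
  by rewrite leeD2l// lee_wpmul2l// lee_fin.
by rewrite -EFinM -EFinD lee_fin; lra.
Qed.
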